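(* Let $G=(V,E)$ be a simple undirected graph with $V=[n]$, $N=\binom n2$, $\mathcal P_n=\{(i,j):i<j\}$ enumerated as $(i_k,j_k)$, $k\in[N]$, $\sigma^*$ a permutation of $[n]$ and $y_k=\operatorname{sign}(\sigma^*(i_k)-\sigma^*(j_k))$. Let $U=[u_1,\dots,u_n]\in\mathrm{Lab}(G)$, $K=U^\top U$, and let $\tilde U\in\mathbb R^{d\times N}$ have columns $\tilde u_k=u_{i_k}-u_{j_k}$. Fix $C>0$, $f\in(0,1/2]$, $m=\lceil Nf\rceil$, let $S\subseteq\mathcal P_n$ with $|S|=m$ be drawn uniformly at random with labels revealed, $\bar S=\mathcal P_n\setminus S$, and let $\ell^\rho:\{\pm1\}\times\mathbb R\to[0,B]$ be a bounded loss, $\rho$-Lipschitz in its second argument. Let $f^*=\tilde U^\top w^*$ be the score vector output by Pref-Rank on $(\tilde U,S,\{y_k\}_{k\in S})$. Then there is a constant $C_1>0$ such that for any $\delta>0$, with probability at least $1-\delta$ over $S$, $$er^{\ell^\rho}_{\bar S}(f^* )\le er^{\ell^\rho}_S(f^* )+\frac{2C\sqrt{n\lambda_1(K)}}{\rho\sqrt{f(1-f)}}+\frac{C_1B}{1-f}\sqrt{\frac{\log(1/\delta)}{Nf}}.$$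
   Context: $\mathrm{Lab}(G)$: matrices $U=[u_1,\dots,u_n]\in\mathbb R^{d\times n}$ with unit columns and $u_i^\top u_j=0$ whenever $i\ne j$, $(i,j)\notin E$. $\lambda_1(K)$ is the largest eigenvalue of $K$. $\rho$-Lipschitz: $|\ell^\rho(y,a)-\ell^\rho(y,a')|\le\frac1\rho|a-a'|$. Pref-Rank with embedding $\tilde U$ and parameter $C$: $w^*\in\arg\min_w\frac12\|w\|_2^2+C\sum_{k\in S}\max(0,1-y_kw^\top\tilde u_k)$, output $f^*=\tilde U^\top w^*$. $er^\ell_S(g)=\frac1{|S|}\sum_{k\in S}\ell(y_k,g_k)$, $er^\ell_{\bar S}(g)=\frac1{|\bar S|}\sum_{k\in\bar S}\ell(y_k,g_k)$. *)

(* Defs.v *)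
From HB Require Import structures.
From mathcomp Require Import all_boot all_order all_algebra all_fingroup.
From mathcomp Require Import all_classical all_reals all_analysis.
Set Implicit Arguments. Unset Strict Implicit. Unset Printing Implicit Defensive.
Import Order.TTheory GRing.Theory Num.Theory.
Local Open Scope ring_scope.

Notation pairs n := {p : 'I_n * 'I_n | (p.1 < p.2)%N}.

Section Defs.
Variable R : realType.

Definition simple_graph n (e : rel 'I_n) : Prop :=
  (forall i j, e i j = e j i) /\ (forall i, ~~ e i i).

Definition in_Lab n d (e : rel 'I_n) (U : 'M[R]_(d, n)) : Prop :=
  (forall i, (U^T *m U) i i = 1) /\
  (forall i j, i != j -> ~~ e i j -> (U^T *m U) i j = 0).

Definition lambda1 n (K : 'M[R]_n) : R := sup [set a : R | eigenvalue K a].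

Definition ylabel n (s : 'S_n) (p : pairs n) : R :=
  if (s (val p).1 < s (val p).2)%N then -1 else 1.

Definition score n d (U : 'M[R]_(d, n)) (w : 'cV[R]_d) (p : pairs n) : R :=
  \sum_(r < d) (U r (val p).1 - U r (val p).2) * w r 0.

Definition prefrank_obj n d (U : 'M[R]_(d, n)) (s : 'S_n) (C : R)
    (S : {set pairs n}) (w : 'cV[R]_d) : R :=
  2^-1 * (\sum_(r < d) w r 0 ^+ 2) +
  C * \sum_(k in S) Num.max 0 (1 - ylabel s k * score U w k).

Definition prefrank_opt n d (U : 'M[R]_(d, n)) (s : 'S_n) (C : R)
    (S : {set pairs n}) (w : 'cV[R]_d) : Prop :=
  forall w', prefrank_obj U s C S w <= prefrank_obj U s C S w'.

Definition er n (s : 'S_n) (l : R -> R -> R) (A : {set pairs n})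
    (g : pairs n -> R) : R :=
  #|A|%:R^-1 * \sum_(k in A) l (ylabel s k) (g k).

End Defs.

(* Main.v *)
Require Import Defs.
From HB Require Import structures.
From mathcomp Require Import all_boot all_order all_algebra all_fingroup.
From mathcomp Require Import all_classical all_reals all_analysis.
From mathcomp Require Import ring lra zify.
Import Order.TTheory GRing.Theory Num.Theory.
Local Open Scope ring_scope.

(** For a fixed finite class of score vectors (one optimum per sample), let
    Phi(S) be the largest difference between the test and the training error on S.
    - Averaging over permutations of the pairs and over sign flips of disjoint
      transpositions, followed by Talagrand's contraction principle, bounds the mean
      of Phi by a linear Rademacher average.  With ||w||^2 <= C^2 m n lambda_1(K),
      which follows from strong convexity of the objective at w and at 0, the mean is
      at most the middle term of the bound, without any additive slack; slack would
      be fatal, since the last term vanishes as delta tends to 1.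
    - Exchanging one sampled pair changes Phi by at most B (1/m + 1/u), where
      u = N - m, and revealing the sample one pair at a time gives a subgaussian tail.
    - The mean bound is too weak only when two of three pairs are observed; there
      the algorithmic stability of the optimum replaces it. *)

(** * Finite maxima, contraction and symmetrization *)

(** A sample acts twice, through the optimum trained on it and through the pairs averaged over;
    indexing the class by all subsets of pairs separates the two roles. Optima on one sample have
    equal scores, so one representative serves for all.

    Signs come from exchanging training and test pairs, which requires lists of equal length,
    whereas the two sets have m and u pairs. Both means are therefore rewritten as averages over
    windows of the common length k = min(m, u).

    Let V be the total squared length of the pair vectors. Since sqrt(f(1-f)) <= 1/2, the mean bound
    fits under the middle term once m V <= 4 k N. As V <= n^2, it suffices that m n <= 2 k (n - 1).
    The ceiling gives m <= u or m = u + 1, and the inequality fails only for n = 3, m = 2 and for n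
    = 2, where the test set is empty.

    The constant 9 is 3 * 3, from N <= 3 u and sqrt 8 <= 3. *)

Section FiniteMax.
Context {R : realType} {T : finType}.
Variable t0 : T.

Definition fmax (F : T -> R) : R := F [arg max_(t > t0) F t]%O.

Lemma fmax_ge F t : F t <= fmax F.
Proof. by rewrite /fmax; case: arg_maxP => // i _; apply. Qed.

Lemma fmax_attained F : exists t, fmax F = F t.
Proof. by exists [arg max_(t > t0) F t]%O. Qed.

Lemma fmax_le F c : (forall t, F t <= c) -> fmax F <= c.
Proof. by move=> Fc; apply: Fc. Qed.

Lemma fmax_leD {F G} c : (forall t, F t <= G t + c) -> fmax F <= fmax G + c.
Proof.
by move=> FG; apply: fmax_le => t; apply: le_trans (FG t) _; rewrite lerD2r fmax_ge.
Qed.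

Lemma fmax_sum_le (I : finType) (F : I -> T -> R) :
  fmax (fun t => \sum_i F i t) <= \sum_i fmax (F i).
Proof. by apply: fmax_le => t; apply: ler_sum => i _; apply: fmax_ge. Qed.

Lemma fmaxZ (c : R) F : 0 <= c -> fmax (fun t => c * F t) = c * fmax F.
Proof.
move=> c0; apply/eqP; rewrite eq_le; apply/andP; split.
  by apply: fmax_le => t; rewrite ler_wpM2l // fmax_ge.
by have [t ->] := fmax_attained F; apply: (fmax_ge (fun t => c * F t)).
Qed.

Lemma eq_fmax {F G} : F =1 G -> fmax F = fmax G.
Proof. by move=> /funext ->. Qed.

End FiniteMax.

Section Contraction.
Context {R : realType} {T : finType}.
Context {k : nat}.
Variable t0 : T.
Implicit Types (q : T -> 'I_k -> R) (eps : {ffun 'I_k -> bool}).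

(** Its average over [eps] is the unnormalised Rademacher complexity of the class [q]. *)
Definition signed_max q eps : R := fmax t0 (fun t => \sum_i (-1) ^+ eps i * q t i).

Definition flip (j : 'I_k) eps : {ffun 'I_k -> bool} :=
  [ffun i => eps i (+) (i == j)].

Lemma flipK j : involutive (flip j).
Proof. by move=> eps; apply/ffunP => i; rewrite !ffunE -addbA addbb addbF. Qed.

(** Pairing [eps] with its flip at [j], the two maxima add up to one maximum over couples [(t, t')]
    of the remaining sums plus a signed difference of the j-th entries. Passing to [q'] enlarges
    that difference in absolute value, and its sign is absorbed by swapping [t] and [t']. *)
Lemma contraction_step j q q' :
  (forall t i, i != j -> q t i = q' t i) ->
  (forall t t', `|q t j - q t' j| <= `|q' t j - q' t' j|) ->
  \sum_eps signed_max q eps <= \sum_eps signed_max q' eps.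
Proof.
move=> qq' qlip.
have dbl p : (\sum_eps signed_max p eps) *+ 2 =
    \sum_eps (signed_max p eps + signed_max p (flip j eps)).
  rewrite big_split /= mulr2n; congr (_ + _).
  by rewrite (reindex_inj (inv_inj (flipK j))).
rewrite -(@ler_pMn2r _ 2%N) // !dbl; apply: ler_sum => eps _.
have split_j p eps' t : \sum_i (-1) ^+ eps' i * p t i =
    (-1) ^+ eps' j * p t j + \sum_(i | i != j) (-1) ^+ eps' i * p t i.
  by rewrite (bigD1 j).
have flip_rest p t : \sum_(i | i != j) (-1) ^+ flip j eps i * p t i =
    \sum_(i | i != j) (-1) ^+ eps i * p t i.
  by apply: eq_bigr => i /negPf ij; rewrite ffunE ij addbF.
have flipj : (-1) ^+ flip j eps j = - (-1) ^+ eps j :> R.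
  by rewrite ffunE eqxx addbT; case: (eps j); rewrite ?opprK.
have rest t : \sum_(i | i != j) (-1) ^+ eps i * q t i =
    \sum_(i | i != j) (-1) ^+ eps i * q' t i.
  by apply: eq_bigr => i ij; rewrite qq'.
have [t Et] := fmax_attained t0 (fun t => \sum_i (-1) ^+ eps i * q t i).
have [t' Et'] := fmax_attained t0 (fun t => \sum_i (-1) ^+ flip j eps i * q t i).
rewrite /signed_max Et Et' !split_j flip_rest flipj !rest.
pose g u := \sum_i (-1) ^+ eps i * q' u i.
pose h u := \sum_i (-1) ^+ flip j eps i * q' u i.
(* Both maxima are bounded below at [t] and at [t'], so either order of the couple is available
   below. *)
have gt := fmax_ge t0 g t; have gt' := fmax_ge t0 g t'.
have ht := fmax_ge t0 h t; have ht' := fmax_ge t0 h t'.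
move: gt gt' ht ht'; rewrite {1}/g {2}/g {1}/h {2}/h !split_j !flip_rest !flipj.
rewrite -/g -/h.
set M1 := fmax t0 g; set M2 := fmax t0 h.
have := qlip t t'.
case: (eps j); rewrite ?expr1 ?expr0.
  by case: (ler0P (q t j - q t' j)); case: (ler0P (q' t j - q' t' j)); lra.
by case: (ler0P (q t j - q t' j)); case: (ler0P (q' t j - q' t' j)); lra.
Qed.

Lemma contraction (q q' : T -> 'I_k -> R) :
  (forall i t t', `|q t i - q t' i| <= `|q' t i - q' t' i|) ->
  \sum_eps signed_max q eps <= \sum_eps signed_max q' eps.
Proof.
move=> qlip.
(* Hybrid argument: the first [m] coordinates are already replaced. *)
pose hyb (m : nat) t (i : 'I_k) := if (i < m)%N then q' t i else q t i.
have hyb_le m : (m <= k)%N -> \sum_eps signed_max q eps <= \sum_eps signed_max (hyb m) eps.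
  elim: m => [_|m IH mk]; first exact: lexx.
  apply: le_trans (IH (ltnW mk)) _.
  apply: (@contraction_step (Ordinal mk)) => [t i ij|t t']; rewrite /hyb /=.
    rewrite ltnS [in RHS]leq_eqVlt; case: eqP => //= im.
    by rewrite -val_eqE /= im eqxx in ij.
  by rewrite ltnn ltnSn.
apply: le_trans (hyb_le k (leqnn k)) _.
rewrite le_eqVlt; apply/orP; left; apply/eqP; apply: eq_bigr => eps _.
by apply: eq_fmax => t; apply: eq_bigr => i _; rewrite /hyb ltn_ord.
Qed.

End Contraction.

(** * Random permutations and random signs *)

Section PermAverage.
Context {R : realType} {P : finType}.

Lemma sum_perm_mull (F : {perm P} -> R) (tau : {perm P}) :
  \sum_pi F (tau * pi)%g = \sum_pi F pi.
Proof. by rewrite [RHS](reindex_inj (mulgI tau)). Qed.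

(** A uniform permutation carries [x] to a uniform point: translating by a transposition shows that
    the sum is the same for every [x], so it may be averaged over [x]. *)
Lemma sum_perm_point (h : P -> R) (x : P) :
  #|P|%:R * \sum_(pi : {perm P}) h (pi x) = #|{perm P}|%:R * \sum_y h y.
Proof.
have indep y : \sum_(pi : {perm P}) h (pi y) = \sum_(pi : {perm P}) h (pi x).
  rewrite -(@sum_perm_mull (fun pi => h (pi x)) (tperm x y)).
  by apply: eq_bigr => pi _; rewrite permM tpermL.
rewrite mulr_natl -[LHS]sumr_const -(eq_bigr _ (fun y _ => indep y)) exchange_big /=.
rewrite mulr_natl -sumr_const; apply: eq_bigr => pi _.
by rewrite [RHS](reindex_inj (@perm_inj _ pi)).
Qed.

(** Realises a sign vector as a permutation, exchanging the i-th couple exactly when [eps i]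
    holds. *)
Lemma swap_perm {k} (c : bool * 'I_k -> P) (eps : {ffun 'I_k -> bool}) :
  injective c ->
  exists tau : {perm P}, forall p, tau (c p) = c (p.1 (+) eps p.2, p.2).
Proof.
move=> c_inj.
pose f x := if [pick p | c p == x] is Some p then c (p.1 (+) eps p.2, p.2) else x.
have fc p : f (c p) = c (p.1 (+) eps p.2, p.2).
  rewrite /f; case: pickP => [q /eqP /c_inj -> //|/(_ p)]; by rewrite eqxx.
have fK : involutive f.
  move=> x; have [/existsP[p /eqP <-]|/existsPn nox] := boolP [exists p, c p == x].
    by rewrite !fc /= -addbA addbb addbF -surjective_pairing.
  have fx : f x = x by rewrite /f; case: pickP => // p; rewrite (negPf (nox p)).
  by rewrite !fx.
by exists (perm (inv_inj fK)) => p; rewrite permE fc.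
Qed.

(** Left translation by the permutation of [swap_perm] keeps the sum over [pi] and negates the i-th
    difference when [eps i] holds. Subadditivity of the maximum separates the two halves; the minus
    sign of the second is absorbed by negating [eps]. *)
Lemma fmax_symmetrization {T : finType} (t0 : T) {k} (c : bool * 'I_k -> P)
    (G : T -> P -> R) :
  injective c ->
  (2 ^ k)%:R * \sum_(pi : {perm P}) fmax t0 (fun t =>
       \sum_i (G t (pi (c (false, i))) - G t (pi (c (true, i))))) <=
  \sum_(pi : {perm P}) \sum_b \sum_eps
     signed_max t0 (fun t i => G t (pi (c (b, i)))) eps.
Proof.
move=> c_inj.
pose Z (pi : {perm P}) := fmax t0 (fun t =>
  \sum_i (G t (pi (c (false, i))) - G t (pi (c (true, i))))).
have card_eps : #|{ffun 'I_k -> bool}| = (2 ^ k)%N by rewrite card_ffun card_bool card_ord.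
have -> : (2 ^ k)%:R * \sum_pi Z pi = \sum_(eps : {ffun 'I_k -> bool}) \sum_pi Z pi.
  by rewrite sumr_const mulr_natl card_eps.
have Zeps (eps : {ffun 'I_k -> bool}) : \sum_pi Z pi <= \sum_(pi : {perm P})
    (signed_max t0 (fun t i => G t (pi (c (false, i)))) eps +
     signed_max t0 (fun t i => G t (pi (c (true, i)))) [ffun i => ~~ eps i]).
  have [tau tauE] := swap_perm _ eps c_inj.
  rewrite -(sum_perm_mull Z tau); apply: ler_sum => pi _; apply: fmax_le => t.
  pose f i := (-1) ^+ eps i * G t (pi (c (false, i))).
  pose g i := (-1) ^+ [ffun i => ~~ eps i] i * G t (pi (c (true, i))).
  apply: (@le_trans _ _ (\sum_i f i + \sum_i g i)); last first.
    apply: lerD.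
      exact: (fmax_ge t0 (fun u => \sum_i (-1) ^+ eps i * G u (pi (c (false, i)))) t).
    exact: (fmax_ge t0 (fun u =>
      \sum_i (-1) ^+ [ffun i => ~~ eps i] i * G u (pi (c (true, i)))) t).
  rewrite -big_split /=; apply: ler_sum => i _; rewrite /f /g ffunE !permM !tauE /=.
  by case: (eps i); rewrite /= ?expr1 ?expr0; lra.
apply: le_trans (ler_sum _ (fun eps _ => Zeps eps)) _.
rewrite exchange_big /=; apply: ler_sum => pi _; rewrite big_split big_bool /= addrC.
apply: lerD; last exact: lexx.
have neg_inj : injective (fun eps : {ffun 'I_k -> bool} => [ffun i => ~~ eps i]).
  by move=> e1 e2 /ffunP e12; apply/ffunP => i; have := e12 i; rewrite !ffunE => /negb_inj.
by rewrite [X in _ <= X](reindex_inj neg_inj).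
Qed.

End PermAverage.

(** * Second moments of signed sums *)

Section Norms.
Context {R : realType}.

(** Lagrange's identity: the double sum of squares is twice the difference of the two sides. *)
Lemma CauchySchwarz_sum {I : finType} (a b : I -> R) :
  (\sum_i a i * b i) ^+ 2 <= (\sum_i a i ^+ 2) * (\sum_i b i ^+ 2).
Proof.
have : 0 <= \sum_i \sum_j (a i * b j - a j * b i) ^+ 2.
  by apply: sumr_ge0 => i _; apply: sumr_ge0 => j _; apply: sqr_ge0.
have -> : \sum_i \sum_j (a i * b j - a j * b i) ^+ 2 =
  \sum_i \sum_j (a i ^+ 2 * b j ^+ 2) + \sum_i \sum_j (a j ^+ 2 * b i ^+ 2)
  - 2 * \sum_i \sum_j ((a i * b i) * (a j * b j)).
  rewrite mulr_sumr -big_split -sumrB /=; apply: eq_bigr => i _.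
  rewrite mulr_sumr -big_split -sumrB /=; apply: eq_bigr => j _; ring.
rewrite [X in _ + X - _]exchange_big /= expr2 !big_distrlr /=; lra.
Qed.

(** Jensen's inequality for the square root, obtained from Cauchy-Schwarz against the constant 1. *)
Lemma sum_sqrt_le {I : finType} (x : I -> R) (q : R) :
  0 <= q -> (forall i, 0 <= x i) -> \sum_i x i <= #|I|%:R * q ->
  \sum_i Num.sqrt (x i) <= #|I|%:R * Num.sqrt q.
Proof.
move=> q0 x0 xq.
have := CauchySchwarz_sum (fun i => Num.sqrt (x i)) (fun=> 1).
under eq_bigr => i _ do rewrite mulr1.
under [X in _ <= X * _]eq_bigr => i _ do rewrite sqr_sqrtr //.
under [X in _ <= _ * X]eq_bigr => i _ do rewrite expr1n.
rewrite sumr_const => h.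
rewrite -(@ler_pXn2r _ 2) ?nnegrE ?sumr_ge0 ?mulr_ge0 ?ler0n ?sqrtr_ge0 //.
apply: le_trans h _; rewrite exprMn sqr_sqrtr // expr2 -mulrA mulrC.
by rewrite ler_wpM2l ?ler0n.
Qed.

Lemma sum_signs {k} (i j : 'I_k) :
  \sum_(eps : {ffun 'I_k -> bool}) ((-1) ^+ eps i * (-1) ^+ eps j) =
  if i == j then (2 ^ k)%:R else 0 :> R.
Proof.
have card_eps : #|{ffun 'I_k -> bool}| = (2 ^ k)%N by rewrite card_ffun card_bool card_ord.
case: eqP => [<-|/eqP ij].
  rewrite (eq_bigr (fun=> 1)) ?sumr_const ?card_eps // => eps _.
  by rewrite -expr2 sqrr_sign.
set s := LHS; suff : s = - s by lra.
rewrite {1}/s (reindex_inj (inv_inj (flipK i))) -sumrN; apply: eq_bigr => eps _.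
rewrite !ffunE eqxx eq_sym (negPf ij) addbF addbT -mulNr; congr (_ * _).
by case: (eps i); rewrite ?opprK.
Qed.

Lemma sum_signs_sqr {k} (x : 'I_k -> R) :
  \sum_(eps : {ffun 'I_k -> bool}) (\sum_i (-1) ^+ eps i * x i) ^+ 2 =
  (2 ^ k)%:R * \sum_i x i ^+ 2.
Proof.
under eq_bigr => eps _ do rewrite expr2 big_distrlr /=.
rewrite exchange_big mulr_sumr /=; apply: eq_bigr => i _; rewrite exchange_big /=.
rewrite (bigD1 i) //= [X in _ + X]big1 ?addr0 => [|j ji].
  under eq_bigr => eps _ do rewrite mulrACA.
  by rewrite -mulr_suml sum_signs eqxx expr2.
under eq_bigr => eps _ do rewrite mulrACA.
by rewrite -mulr_suml sum_signs eq_sym (negPf ji) mul0r.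
Qed.

Lemma signed_max_linear_le {T : finType} (t0 : T) {k d} (w : T -> 'I_d -> R)
    (v : 'I_k -> 'I_d -> R) (W : R) eps :
  0 <= W -> (forall t, \sum_r w t r ^+ 2 <= W ^+ 2) ->
  signed_max t0 (fun t i => \sum_r v i r * w t r) eps <=
  W * Num.sqrt (\sum_r (\sum_i (-1) ^+ eps i * v i r) ^+ 2).
Proof.
move=> W0 wW; apply: fmax_le => t; set s := \sum_i _.
have -> : s = \sum_r (\sum_i (-1) ^+ eps i * v i r) * w t r.
  rewrite /s; under eq_bigr => i _ do rewrite mulr_sumr.
  rewrite exchange_big; apply: eq_bigr => r _ /=.
  by rewrite mulr_suml; apply: eq_bigr => i _; rewrite mulrA.
have := CauchySchwarz_sum (fun r => \sum_i (-1) ^+ eps i * v i r) (w t).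
set V := \sum_r _ ^+ 2 => h.
have V0 : 0 <= V by apply: sumr_ge0 => r _; apply: sqr_ge0.
have rhs0 : 0 <= W * Num.sqrt V by rewrite mulr_ge0 ?sqrtr_ge0.
apply: le_trans (ler_norm _) _.
rewrite -(@ler_pXn2r _ 2) ?nnegrE // real_normK ?num_real // exprMn sqr_sqrtr //.
by apply: le_trans h _; rewrite mulrC ler_wpM2r.
Qed.

End Norms.

Section SymmetrizedBound.
Context {R : realType} {P T : finType} {d : nat}.
Variables (t0 : T) (w : T -> 'I_d -> R) (v : P -> 'I_d -> R) (W : R).
Hypotheses (W0 : 0 <= W) (wW : forall t, \sum_r w t r ^+ 2 <= W ^+ 2).

(** Jensen is applied to [pi] and [eps] jointly. The signs then remove the cross terms of the
    squared norm, and each [pi (b i)] is uniform on [P], so each of the [k] indices contributes the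
    average squared length. *)
Lemma sum_signed_max_le k (b : 'I_k -> P) :
  (0 < #|P|)%N ->
  \sum_(pi : {perm P}) \sum_(eps : {ffun 'I_k -> bool})
    signed_max t0 (fun t i => \sum_r v (pi (b i)) r * w t r) eps <=
  (#|{perm P}| * 2 ^ k)%:R * (W * Num.sqrt
    (k%:R * (#|P|%:R^-1 * \sum_x \sum_r v x r ^+ 2))).
Proof.
move=> P0; have NP0 : #|P|%:R != 0 :> R by rewrite pnatr_eq0 -lt0n.
pose q (pi : {perm P}) (eps : {ffun 'I_k -> bool}) :=
  \sum_r (\sum_i (-1) ^+ eps i * v (pi (b i)) r) ^+ 2.
have q0 pi eps : 0 <= q pi eps by apply: sumr_ge0 => r _; apply: sqr_ge0.
have card_eps : #|{ffun 'I_k -> bool}| = (2 ^ k)%N by rewrite card_ffun card_bool card_ord.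
have step : \sum_(pi : {perm P}) \sum_(eps : {ffun 'I_k -> bool})
    signed_max t0 (fun t i => \sum_r v (pi (b i)) r * w t r) eps <= W *
    \sum_(pi : {perm P}) \sum_(eps : {ffun 'I_k -> bool}) Num.sqrt (q pi eps).
  rewrite mulr_sumr; apply: ler_sum => pi _; rewrite mulr_sumr; apply: ler_sum => eps _.
  exact: (signed_max_linear_le t0 w (fun i => v (pi (b i)))).
apply: le_trans step _.
rewrite [leRHS]mulrCA ler_wpM2l // pair_bigA /= -card_eps -card_prod.
apply: sum_sqrt_le => [|p|]; last 1 first.
- rewrite -(pair_bigA _ (fun pi eps => q pi eps)) /=.
  have -> : \sum_(pi : {perm P}) \sum_(eps : {ffun 'I_k -> bool}) q pi eps =
      (2 ^ k)%:R * \sum_i \sum_(pi : {perm P}) \sum_r v (pi (b i)) r ^+ 2.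
    rewrite [in RHS]exchange_big mulr_sumr /=; apply: eq_bigr => pi _ /=.
    rewrite exchange_big /=; under eq_bigr => r _ do rewrite sum_signs_sqr.
    by rewrite -mulr_sumr [in RHS]exchange_big.
  have onept x : \sum_(pi : {perm P}) \sum_r v (pi x) r ^+ 2 =
      #|P|%:R^-1 * (#|{perm P}|%:R * \sum_y \sum_r v y r ^+ 2).
    by rewrite -(sum_perm_point (fun y => \sum_r v y r ^+ 2) x) mulKf.
  rewrite (eq_bigr _ (fun i _ => onept (b i))).
  rewrite sumr_const card_ord card_prod card_eps natrM -mulr_natl.
  by rewrite le_eqVlt; apply/orP; left; apply/eqP; ring.
- rewrite mulr_ge0 ?ler0n // mulr_ge0 ?invr_ge0 ?ler0n //.
  by apply: sumr_ge0 => x _; apply: sumr_ge0 => r _; apply: sqr_ge0.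
- exact: q0.
Qed.

Lemma perm_fmax_le (G : T -> P -> R) k (c : bool * 'I_k -> P) :
  (0 < #|P|)%N -> injective c ->
  (forall x t t', `|G t x - G t' x| <=
     `|\sum_r v x r * w t r - \sum_r v x r * w t' r|) ->
  \sum_(pi : {perm P}) fmax t0 (fun t =>
       \sum_i (G t (pi (c (false, i))) - G t (pi (c (true, i))))) <=
  #|{perm P}|%:R * (2 * (W * Num.sqrt
    (k%:R * (#|P|%:R^-1 * \sum_x \sum_r v x r ^+ 2)))).
Proof.
move=> P0 c_inj Glip.
have pow0 : 0 < (2 ^ k)%:R :> R by rewrite ltr0n expn_gt0.
rewrite -(ler_pM2l pow0); apply: le_trans (fmax_symmetrization t0 c G c_inj) _.
rewrite exchange_big big_bool /=.
have bnd b := le_trans (ler_sum _ (fun (pi : {perm P}) _ =>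
  contraction t0 (fun t i => G t (pi (c (b, i))))
    (fun t i => \sum_r v (pi (c (b, i))) r * w t r)
    (fun i => Glip (pi (c (b, i)))))) (sum_signed_max_le k (fun i => c (b, i)) P0).
apply: le_trans (lerD (bnd true) (bnd false)) _.
by rewrite natrM le_eqVlt; apply/orP; left; apply/eqP; ring.
Qed.

End SymmetrizedBound.

(** * Means over samples of fixed size *)

Section Mean.
Context {R : realType} {I : finType}.
Implicit Types (A : {set I}) (F G : I -> R).

(** On the empty set this is 0, because the inverse of 0 is 0; the case of an empty test set relies
    on that convention. *)
Definition mean A F : R := #|A|%:R^-1 * \sum_(i in A) F i.

Lemma eq_mean A F G : {in A, F =1 G} -> mean A F = mean A G.
Proof. by move=> FG; congr (_ * _); apply: eq_bigr. Qed.

Lemma ler_mean A F G : {in A, forall i, F i <= G i} -> mean A F <= mean A G.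
Proof. by move=> FG; rewrite ler_wpM2l ?invr_ge0 ?ler0n //; apply: ler_sum. Qed.

Lemma mean_cst A c : A != finset.set0 -> mean A (fun=> c) = c.
Proof.
rewrite -finset.card_gt0 => A0; rewrite /mean sumr_const -[c *+ _]mulr_natl mulKf //.
by rewrite pnatr_eq0 -lt0n.
Qed.

Lemma meanD A F G : mean A (fun i => F i + G i) = mean A F + mean A G.
Proof. by rewrite /mean big_split mulrDr. Qed.

Lemma meanZ A c F : mean A (fun i => c * F i) = c * mean A F.
Proof. by rewrite /mean -mulr_sumr mulrCA. Qed.

Lemma sum_mean A F : A != finset.set0 -> \sum_(i in A) F i = #|A|%:R * mean A F.
Proof.
rewrite -finset.card_gt0 => A0; rewrite /mean mulVKf //.
by rewrite pnatr_eq0 -lt0n.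
Qed.

Lemma mean_imset (J : finType) (f : J -> I) (D : {set J}) F :
  injective f -> mean (f @: D) F = #|D|%:R^-1 * \sum_(j in D) F (f j).
Proof.
by move=> f_inj; rewrite /mean card_imset // big_imset //; apply: in2W.
Qed.

(** Test minus training error, with [A] as the training sample. *)
Definition gap A F : R := mean (~: A) F - mean A F.

Lemma gap_perm A F (pi : {perm I}) : gap (pi @: A) F = gap A (F \o pi).
Proof.
rewrite /gap; have -> : ~: (pi @: A) = pi @: (~: A).
  apply/finset.setP => x; rewrite -[x](permKV pi) finset.in_setC.
  by rewrite !(mem_imset _ _ (@perm_inj _ pi)) finset.in_setC.
by rewrite !mean_imset //; exact: perm_inj.
Qed.

End Mean.

Section ExpectedGap.
Context {R : realType} {P : finType}.

(* The rows of [b] are the cyclic windows of length [k] in an enumeration of [X]. *)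
Lemma cyclic_windows u k (X : {set P}) :
  #|X| = u.+1 -> (k <= u.+1)%N ->
  exists b : 'I_u.+1 -> 'I_k -> P,
    [/\ forall r i, b r i \in X, forall r, injective (b r) &
        forall F : P -> R, \sum_r \sum_i F (b r i) = k%:R * \sum_(x in X) F x].
Proof.
move=> Xu ku; have szX : size (enum X) = u.+1 by rewrite -cardE.
have [x0 _] : exists x0, x0 \in X by apply/card_gt0P; rewrite Xu.
pose e (r : 'I_u.+1) := nth x0 (enum X) r.
have e_inj : injective e.
  move=> r r' /eqP; rewrite nth_uniq ?enum_uniq ?szX ?ltn_ord // => /eqP h.
  exact: val_inj.
exists (fun r i => e (r + inord i)); split=> [r i|r i j /e_inj/addrI|F].
- by rewrite -mem_enum mem_nth // szX ltn_ord.
- move=> /(congr1 val); rewrite /= !inordK; try exact: leq_trans ku.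
  by move/val_inj.
- rewrite exchange_big /= mulr_natl -[in RHS](card_ord k) -sumr_const.
  apply: eq_bigr => i _.
  rewrite -[in RHS]big_enum (big_nth x0) szX big_mkord.
  by rewrite [RHS](reindex_inj (addIr (inord i : 'I_u.+1))).
Qed.

Variables (T : finType) (d : nat) (t0 : T) (w : T -> 'I_d -> R) (v : P -> 'I_d -> R).
Variables (W : R) (G : T -> P -> R).
Hypotheses (W0 : 0 <= W) (wW : forall t, \sum_r w t r ^+ 2 <= W ^+ 2).
Hypothesis Glip : forall x t t', `|G t x - G t' x| <=
     `|\sum_r v x r * w t r - \sum_r v x r * w t' r|.

(** A window in [S] and a window in its complement are disjoint and equally long, so [perm_fmax_le]
    applies to each couple of windows. The gap is an average over all couples, and the maximum is
    subadditive. *)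
Lemma sum_perm_gap_le (S : {set P}) k :
  (0 < k)%N -> (k <= #|S|)%N -> (k <= #|~: S|)%N ->
  \sum_(pi : {perm P}) fmax t0 (fun t => gap (pi @: S) (G t)) <=
  #|{perm P}|%:R * (2 * (k%:R^-1 * (W * Num.sqrt
    (k%:R * (#|P|%:R^-1 * \sum_x \sum_r v x r ^+ 2))))).
Proof.
move=> k0 kS kT.
have k0' : 0 < k%:R :> R by rewrite ltr0n.
have : (0 < #|S|)%N by apply: leq_trans kS.
have : (0 < #|~: S|)%N by apply: leq_trans kT.
case mE : #|S| kS => [//|m] kS; case uE : #|~: S| kT => [//|u] kT _ _.
have [b [bT b_inj bE]] := cyclic_windows _ _ _ uE kT.
have [c [cS c_inj cE]] := cyclic_windows _ _ _ mE kS.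
have P0 : (0 < #|P|)%N.
  by have := max_card (mem S); rewrite mE; apply: leq_trans.
pose win r r' (p : bool * 'I_k) := if p.1 then c r' p.2 else b r p.2.
have win_inj r r' : injective (win r r').
  move=> [[] i] [[] j]; rewrite /win /=.
  - by move/c_inj ->.
  - by move=> h; have := bT r j; rewrite inE -h cS.
  - by move=> h; have := bT r i; rewrite inE h cS.
  - by move/b_inj ->.
(* There are [u.+1 * m.+1] couples of windows, and a window sum is on average [k] times the mean. *)
pose Z := u.+1%:R^-1 * m.+1%:R^-1 * k%:R^-1 : R.
have Z0 : 0 <= Z by rewrite !mulr_ge0 ?invr_ge0 ?ler0n.
pose q := W * Num.sqrt (k%:R * (#|P|%:R^-1 * \sum_x \sum_r v x r ^+ 2)).
pose D r r' (pi : {perm P}) t :=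
  \sum_i (G t (pi (win r r' (false, i))) - G t (pi (win r r' (true, i)))).
have gapE (pi : {perm P}) t : gap (pi @: S) (G t) = Z * \sum_r \sum_r' D r r' pi t.
  rewrite gap_perm /gap /mean uE mE.
  have -> : \sum_r \sum_r' D r r' pi t =
      m.+1%:R * \sum_r \sum_i G t (pi (b r i)) -
      u.+1%:R * \sum_r' \sum_i G t (pi (c r' i)).
    have -> : m.+1%:R * \sum_r \sum_i G t (pi (b r i)) =
        \sum_r \sum_(r' : 'I_m.+1) \sum_i G t (pi (b r i)).
      by rewrite mulr_sumr; apply: eq_bigr => r _; rewrite sumr_const card_ord mulr_natl.
    rewrite mulr_natl -[in X in _ - X](card_ord u.+1) -sumr_const -sumrB.
    by apply: eq_bigr => r _; rewrite -sumrB; apply: eq_bigr => r' _; rewrite -sumrB.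
  rewrite (bE (fun x => G t (pi x))) (cE (fun x => G t (pi x))) /Z.
  have ne a : a.+1%:R != 0 :> R by rewrite pnatr_eq0.
  have := ne u; have := ne m; have : k%:R != 0 :> R by rewrite gt_eqF.
  move: (_.+1%:R) (_.+1%:R) => x y k1 x0 y0; field; by rewrite k1 x0 y0.
have gap_le (pi : {perm P}) : fmax t0 (fun t => gap (pi @: S) (G t)) <=
    Z * \sum_r \sum_r' fmax t0 (D r r' pi).
  rewrite (eq_fmax t0 (gapE pi)) fmaxZ // ler_wpM2l //.
  apply: le_trans (fmax_sum_le _ _ (fun r t => \sum_r' D r r' pi t)) _.
  by apply: ler_sum => r _; apply: fmax_sum_le.
apply: le_trans (ler_sum _ (fun pi _ => gap_le pi)) _.
rewrite -mulr_sumr exchange_big /=.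
under eq_bigr => r _ do rewrite exchange_big /=.
have Dle r r' : \sum_(pi : {perm P}) fmax t0 (D r r' pi) <= #|{perm P}|%:R * (2 * q).
  exact: perm_fmax_le.
apply: (@le_trans _ _ (Z * \sum_(r : 'I_u.+1) \sum_(r' : 'I_m.+1)
   (#|{perm P}|%:R * (2 * q)))).
  by rewrite ler_wpM2l //; apply: ler_sum => r _; apply: ler_sum => r' _.
rewrite !sumr_const !card_ord -/q -mulrnA -[_ *+ (_ * _)]mulr_natl natrM.
rewrite le_eqVlt; apply/orP; left; apply/eqP; rewrite /Z.
have ne a : a.+1%:R != 0 :> R by rewrite pnatr_eq0.
have := ne u; have := ne m; have : k%:R != 0 :> R by rewrite gt_eqF.
move: (_.+1%:R) (_.+1%:R) => x y k1 x0 y0; field; by rewrite k1 x0 y0.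
Qed.

(** A permutation of [P] permutes the subsets of size [m], so the average over samples can first be
    averaged over permutations. *)
Lemma mean_gap_le m k :
  (0 < k)%N -> (k <= m)%N -> (k + m <= #|P|)%N ->
  mean [set S : {set P} | #|S| == m] (fun S => fmax t0 (fun t => gap S (G t))) <=
  2 * (k%:R^-1 * (W * Num.sqrt (k%:R * (#|P|%:R^-1 * \sum_x \sum_r v x r ^+ 2)))).
Proof.
move=> k0 km kmP; set A := finset _; set q := (X in _ <= X).
have perm0 : 0 < #|{perm P}|%:R :> R.
  by rewrite ltr0n; apply/card_gt0P; exists 1%g.
have [A0|A0] := eqVneq A finset.set0.
  by rewrite /mean A0 big_set0 mulr0 /q !mulr_ge0 ?invr_ge0 ?ler0n ?sqrtr_ge0.
have inv (pi : {perm P}) (F : {set P} -> R) :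
    \sum_(S in A) F (pi @: S) = \sum_(S in A) F S.
  rewrite [RHS](reindex_inj (imset_inj (@perm_inj _ pi))) /=.
  by apply: eq_bigl => S; rewrite !inE card_imset //; exact: perm_inj.
pose Phi S := fmax t0 (fun t => gap S (G t)).
have main : #|{perm P}|%:R * \sum_(S in A) Phi S <= #|{perm P}|%:R * (#|A|%:R * q).
  rewrite mulr_natl -sumr_const -(eq_bigr _ (fun pi _ => inv pi Phi)) exchange_big /=.
  rewrite mulrCA mulr_natl -sumr_const; apply: ler_sum => S; rewrite inE => /eqP Sm.
  apply: sum_perm_gap_le => //; rewrite ?Sm //.
  rewrite cardsCs finset.setCK Sm; lia.
rewrite ler_pM2l // in main.
rewrite /mean ler_pdivrMl // ltr0n finset.card_gt0 //.
Qed.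

End ExpectedGap.

(** * Concentration under sampling without replacement *)

Section Concentration.
Context {R : realType}.

(** From [1 - x <= expR (- x)], the exponential is at most 1/(1-x), and (1 + x + 2x^2)(1 - x) = 1 +
    x^2 (1 - 2x) >= 1. *)
Lemma expR_le_quadratic (x : R) : x <= 2^-1 -> expR x <= 1 + x + 2 * x ^+ 2.
Proof.
move=> x2; have x1 : 0 < 1 - x by lra.
have h : 1 - x <= (expR x)^-1 by rewrite -expRN; exact: expR_ge1Dx.
have e0 := expR_gt0 x.
have h1 : expR x * (1 - x) <= 1 by rewrite mulrC -ler_pdivlMr // div1r.
rewrite -(ler_pM2r x1); apply: le_trans h1 _.
have : 0 <= x ^+ 2 * (1 - 2 * x) by rewrite mulr_ge0 ?sqr_ge0 //; lra.
rewrite (_ : (1 + x + 2 * x ^+ 2) * (1 - x) = 1 + x ^+ 2 * (1 - 2 * x)); first lra.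
ring.
Qed.

Lemma mean_dist_le {I : finType} (A : {set I}) (F : I -> R) (beta : R) i :
  (forall j, j \in A -> `|F i - F j| <= beta) -> i \in A ->
  `|F i - mean A F| <= beta.
Proof.
move=> Fb iA; have A0 : A != finset.set0 by apply/finset.set0Pn; exists i.
rewrite ler_norml; apply/andP; split.
  rewrite lerBrDr -lerBrDl opprK -(mean_cst A (F i + beta) A0); apply: ler_mean => j jA.
  by have := Fb j jA; rewrite ler_norml; lra.
rewrite lerBlDr -lerBlDl -(mean_cst A (F i - beta) A0); apply: ler_mean => j jA.
by have := Fb j jA; rewrite ler_norml; lra.
Qed.

(** Hoeffding's lemma with constant 2 in place of 1/8: the linear term averages to zero. The
    restriction on [lam * beta] comes from [expR_le_quadratic]. *)
Lemma mean_exp_le {I : finType} (A : {set I}) (F : I -> R) (beta lam : R) :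
  (forall i j, i \in A -> j \in A -> `|F i - F j| <= beta) ->
  0 <= lam -> lam * beta <= 2^-1 ->
  mean A (fun i => expR (lam * (F i - mean A F))) <= expR (2 * (lam * beta) ^+ 2).
Proof.
move=> Fb lam0 lamb.
have [->|A0] := eqVneq A finset.set0.
  by rewrite {1}/mean big_set0 mulr0 expR_ge0.
set mu := mean A F.
have dist i : i \in A -> `|lam * (F i - mu)| <= lam * beta.
  move=> iA; rewrite normrM (ger0_norm lam0) ler_wpM2l //.
  by apply: mean_dist_le => // j; apply: Fb.
apply: (@le_trans _ _ (mean A (fun i => (1 + 2 * (lam * beta) ^+ 2) + lam * (F i - mu)))).
  apply: ler_mean => i iA; have d := dist i iA.
  have small : lam * (F i - mu) <= 2^-1 by apply: le_trans lamb; apply: ler_normlW.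
  apply: le_trans (expR_le_quadratic _ small) _.
  have : (lam * (F i - mu)) ^+ 2 <= (lam * beta) ^+ 2.
    by rewrite -[in X in X <= _]real_normK ?num_real // lerXn2r ?nnegrE // (le_trans _ d).
  lra.
rewrite meanD mean_cst // meanZ meanD mean_cst // subrr mulr0 addr0.
exact: expR_ge1Dx.
Qed.

Lemma imset_tperm_setU1 {P : finType} (x y z : P) (S : {set P}) :
  x != y -> x != z -> tperm y z @: (x |: S) = x |: (tperm y z @: S).
Proof. by move=> xy xz; rewrite imsetU1 tpermD // eq_sym. Qed.

Definition slice {P : finType} (X : {set P}) (m : nat) : {set {set P}} :=
  [set S : {set P} | S \subset X & #|S| == m].

Lemma card_slice {P : finType} (X : {set P}) m : #|slice X m| = 'C(#|X|, m).
Proof. exact: cards_draws. Qed.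

(* Each [m.+1]-subset arises from [m.+1] choices of its distinguished point. *)
Lemma sum_sliceS {P : finType} (X : {set P}) m (F : {set P} -> R) :
  \sum_(x in X) \sum_(S in slice (X :\ x) m) F (x |: S) =
  m.+1%:R * \sum_(S in slice X m.+1) F S.
Proof.
transitivity (\sum_(x in X) \sum_(S in slice X m.+1 | x \in S) F S).
  apply: eq_bigr => x xX.
  rewrite [RHS](reindex_onto (fun S => x |: S) (fun S => S :\ x)); last first.
    by move=> S /andP[_ xS]; rewrite finset.setD1K.
  apply: eq_bigl => S; rewrite !inE eqxx /= andbT.
  rewrite finset.subsetD1 finset.subUset finset.sub1set xX /= cardsU1.
  have [xS|xS] := boolP (x \in S).
    have neq : (x |: S) :\ x == S = false.
      by apply/negbTE/eqP => /finset.setP/(_ x); rewrite !inE eqxx xS.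
    by rewrite neq !andbF.
  by rewrite finset.setU1K // eqxx !andbT add1n eqSS.
rewrite (exchange_big_dep (mem (slice X m.+1))) /=; last by move=> x S _ /andP[].
rewrite mulr_sumr; apply: eq_bigr => S; rewrite inE => /andP[SX /eqP Sm].
rewrite -Sm mulr_natl -sumr_const; apply: eq_bigl => x.
rewrite SX eqxx /=.
by case: (boolP (x \in S)) => [/(fintype.subsetP SX) ->|]; rewrite ?andbF.
Qed.

(** Drawing a uniform subset amounts to drawing one point and then a uniform subset of the rest. *)
Lemma mean_sliceS {P : finType} (X : {set P}) m (F : {set P} -> R) :
  (m.+1 <= #|X|)%N ->
  mean (slice X m.+1) F = mean X (fun x => mean (slice (X :\ x) m) (fun S => F (x |: S))).
Proof.
move=> mX; set a := 'C(#|X|.-1, m).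
have card_a x : x \in X -> #|slice (X :\ x) m| = a.
  by move=> xX; rewrite card_slice /a [in RHS](cardsD1 x X) xX.
rewrite /mean (eq_bigr (fun x => a%:R^-1 * \sum_(S in slice (X :\ x) m) F (x |: S)));
  last by move=> x xX; rewrite card_a.
rewrite -mulr_sumr sum_sliceS card_slice !mulrA; congr (_ * _).
have X0 : (0 < #|X|)%N by apply: leq_trans mX.
have binE : (m.+1 * 'C(#|X|, m.+1) = #|X| * a)%N.
  by rewrite /a -{1}(prednK X0) -mul_bin_diag prednK.
have ne (k : nat) : (0 < k)%N -> k%:R != 0 :> R by rewrite pnatr_eq0 lt0n.
have c0 := ne _ (_ : 0 < 'C(#|X|, m.+1))%N; rewrite bin_gt0 in c0.
have a0 : a%:R != 0 :> R by rewrite ne // bin_gt0 -ltnS prednK.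
have {}c0 := c0 mX; have x0 := ne _ X0.
have {}binE : m.+1%:R * 'C(#|X|, m.+1)%:R = #|X|%:R * a%:R :> R by rewrite -!natrM binE.
by apply: (mulIf c0); rewrite mulVf // -[RHS]mulrA binE; field; rewrite x0 a0.
Qed.

(** Doob's martingale as an induction: [Psi x] is the conditional mean given the first point drawn.
    Its fluctuation is handled by [mean_exp_le], that of the remaining draw by induction, and the
    exponents add up. *)
Lemma slice_exp_le {P : finType} (beta lam : R) m :
  0 <= lam -> lam * beta <= 2^-1 ->
  forall (X : {set P}) (Phi : {set P} -> R), (m <= #|X|)%N ->
  (forall x y S, x \in X -> y \in X -> S \in slice X m ->
     `|Phi (tperm x y @: S) - Phi S| <= beta) ->
  mean (slice X m) (fun S => expR (lam * (Phi S - mean (slice X m) Phi))) <=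
  expR (m%:R * (2 * (lam * beta) ^+ 2)).
Proof.
move=> lam0 lamb; elim: m => [|m IH] X Phi mX Lip.
  have -> : slice X 0 = [set finset.set0].
    apply/finset.setP => S; rewrite !inE cards_eq0.
    by case: eqP => [->|]; rewrite ?finset.sub0set ?andbF.
  have m1 G : mean [set finset.set0 : {set P}] G = G finset.set0.
    by rewrite /mean cards1 invr1 mul1r finset.big_set1.
  by rewrite !m1 subrr mulr0 mul0r.
pose Psi x := mean (slice (X :\ x) m) (fun S => Phi (x |: S)).
have mean_Psi : mean (slice X m.+1) Phi = mean X Psi by rewrite mean_sliceS.
have Psi_lip x y : x \in X -> y \in X -> `|Psi x - Psi y| <= beta.
  move=> xX yX; have tX : tperm x y @: (X :\ x) = X :\ y.
    apply/finset.setP => z; rewrite -[z](permKV (tperm x y)).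
    rewrite (mem_imset _ _ (@perm_inj _ _)); move: ((tperm x y)^-1%g z) => {}z.
    rewrite !inE; case: tpermP => [->|->|/eqP zx /eqP zy].
    - by rewrite !eqxx.
    - by rewrite xX yX !andbT eq_sym.
    - by rewrite zx zy.
  have tK (A : {set P}) : tperm x y @: (tperm x y @: A) = A.
    by rewrite -imset_comp (eq_imset (g := id)) ?imset_id // => z; rewrite /= tpermK.
  (* The transposition matches the samples containing [x] drawn first with those for [y], so the two
     conditional means are compared sample by sample. *)
  have -> : Psi y = mean (slice (X :\ x) m) (fun S => Phi (tperm x y @: (x |: S))).
    rewrite /Psi; have -> : slice (X :\ y) m =
        (fun S : {set P} => tperm x y @: S) @: slice (X :\ x) m.
      apply/finset.setP => S; apply/idP/imsetP => [|[S' + ->]].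
        rewrite inE => /andP[Sy Sm]; exists (tperm x y @: S); last by rewrite tK.
        rewrite inE card_imset ?Sm ?andbT; last exact: perm_inj.
        by rewrite -tX in Sy; have := imsetS (tperm x y) Sy; rewrite tK.
      rewrite !inE -tX => /andP[S'x S'm].
      by rewrite imsetS //= card_imset //; exact: perm_inj.
    rewrite mean_imset; last exact/imset_inj/perm_inj.
    by rewrite /mean; congr (_ * _); apply: eq_bigr => S _; rewrite imsetU1 tpermL.
  rewrite -mulN1r -meanZ -meanD /=; set D := (X in mean _ X).
  have cardX' : (m <= #|X :\ x|)%N by rewrite (cardsD1 x X) xX in mX.
  have ne : slice (X :\ x) m != finset.set0.
    by rewrite -finset.card_gt0 card_slice bin_gt0.
  have Db S : S \in slice (X :\ x) m -> `|D S| <= beta.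
    rewrite inE finset.subsetD1 => /andP[/andP[SX xS] Sm].
    rewrite /D mulN1r distrC; apply: Lip => //.
    by rewrite inE finset.subUset finset.sub1set xX SX cardsU1 xS add1n eqSS.
  rewrite ler_norml -{1}(mean_cst _ (- beta) ne) -[X in _ && (_ <= X)](mean_cst _ beta ne).
  by apply/andP; split; apply: ler_mean => S /Db; rewrite ler_norml => /andP[].
rewrite [X in X <= _]mean_sliceS //.
pose c := expR (m%:R * (2 * (lam * beta) ^+ 2)).
apply: (@le_trans _ _ (mean X (fun x => c * expR (lam * (Psi x - mean X Psi))))).
  apply: ler_mean => x xX; rewrite mean_Psi.
  have cardX' : (m <= #|X :\ x|)%N by rewrite (cardsD1 x X) xX in mX.
  have := IH (X :\ x) (fun S => Phi (x |: S)) cardX'; rewrite -/(Psi x) -/c => IHx.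
  under eq_mean => S SX.
    rewrite (_ : lam * _ =
      lam * (Psi x - mean X Psi) + lam * (Phi (x |: S) - Psi x)); last ring.
    rewrite expRD; over.
  rewrite meanZ mulrC ler_wpM2r ?expR_ge0 //; apply: IHx => y z S.
  rewrite !inE => /andP[yx yX] /andP[zx zX].
  rewrite finset.subsetD1 => /andP[/andP[SX xS] Sm].
  (* Transpositions inside [X :\ x] fix [x], so the bounded difference property passes to the
     conditional problem. *)
  rewrite -imset_tperm_setU1 1?eq_sym //; apply: Lip => //.
  by rewrite inE finset.subUset finset.sub1set xX SX cardsU1 xS add1n eqSS.
rewrite meanZ.
apply: le_trans (ler_wpM2l (expR_ge0 _) (mean_exp_le _ _ _ _ Psi_lip lam0 lamb)) _.
by rewrite /c -expRD -(addn1 m) natrD (mulrDl m%:R) mul1r lexx.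
Qed.

End Concentration.

Lemma slice_tail_le {R : realType} {P : finType} (X : {set P}) (Phi : {set P} -> R)
    (beta eps : R) m :
  (0 < m)%N -> (m <= #|X|)%N -> 0 < beta ->
  (forall x y S, x \in X -> y \in X -> S \in slice X m ->
     `|Phi (tperm x y @: S) - Phi S| <= beta) ->
  0 <= eps -> eps <= 2 * (m%:R * beta) ->
  #|[set S in slice X m | mean (slice X m) Phi + eps < Phi S]|%:R <=
  #|slice X m|%:R * expR (- (eps ^+ 2 / (8 * m%:R * beta ^+ 2))).
Proof.
move=> m0 mX b0 Lip eps0 epsb; set mu := mean _ _; set Bad := [set S in _ | _].
have m0' : 0 < m%:R :> R by rewrite ltr0n.
have mb0 : 0 < m%:R * beta by rewrite mulr_gt0.
(* Chernoff's method: this value minimises 2 m lam^2 beta^2 - lam eps, and [eps <= 2 m beta] is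
   exactly [lam * beta <= 1/2]. *)
pose lam := eps / (4 * m%:R * beta ^+ 2).
have lam0 : 0 <= lam by rewrite divr_ge0 // !mulr_ge0 ?sqr_ge0 ?ltW.
have lamb : lam * beta = 4^-1 * (eps / (m%:R * beta)).
  by rewrite /lam; field; rewrite !gt_eqF.
have lamb2 : lam * beta <= 2^-1.
  have : eps / (m%:R * beta) <= 2 by rewrite ler_pdivrMr.
  rewrite lamb; lra.
have ne : slice X m != finset.set0 by rewrite -finset.card_gt0 card_slice bin_gt0.
have := slice_exp_le _ _ m lam0 lamb2 X Phi mX Lip; rewrite -/mu => expb.
set q := (X in _ * expR (- X)).
have -> : expR (- q) = expR (m%:R * (2 * (lam * beta) ^+ 2)) * expR (- (lam * eps)).
  rewrite -expRD lamb /q /lam; congr expR; field; by rewrite !gt_eqF.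
rewrite expRN mulrA ler_pdivlMr ?expR_gt0 //.
apply: (@le_trans _ _ (\sum_(S in slice X m) expR (lam * (Phi S - mu)))); last first.
  by rewrite sum_mean // ler_wpM2l ?ler0n.
rewrite mulr_natl -sumr_const [leRHS](bigID (mem Bad)) /=.
apply: (@le_trans _ _ (\sum_(S in Bad) expR (lam * (Phi S - mu)))).
  apply: ler_sum => S; rewrite inE => /andP[_ h].
  by rewrite ler_expR ler_wpM2l // lerBrDl ltW.
rewrite (eq_bigl (fun S => (S \in slice X m) && (S \in Bad))); last first.
  by move=> S; rewrite [S \in Bad]inE; case: (S \in slice X m).
by rewrite lerDl sumr_ge0 // => S _; apply: expR_ge0.
Qed.

(** If [A] contains both points or neither, nothing changes; otherwise a single value in [0, B] is
    replaced by another. *)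
Lemma sum_tperm_dist {R : realType} {P : finType} (A : {set P}) (F : P -> R) (B : R) x y :
  (forall i, 0 <= F i <= B) ->
  `|\sum_(i in A) F (tperm x y i) - \sum_(i in A) F i| <= B.
Proof.
move=> FB; have B0 : 0 <= B by have /andP[] := FB x; apply: le_trans.
have [->|xy] := eqVneq x y.
  by under eq_bigr => i _ do rewrite tperm1 perm1; rewrite subrr normr0.
rewrite -sumrB big_mkcond (bigD1 x) //= (bigD1 y) 1?eq_sym //= big1 ?addr0; last first.
  move=> i /andP[ix iy]; rewrite tpermD 1?eq_sym // subrr; by case: ifP.
rewrite tpermL tpermR.
have /andP[x0 x1] := FB x; have /andP[y0 y1] := FB y.
by case: (x \in A); case: (y \in A); rewrite ler_norml; apply/andP; split; lra.
Qed.

Lemma gap_tperm_dist {R : realType} {P : finType} (S : {set P}) (F : P -> R) (B : R) x y :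
  (forall i, 0 <= F i <= B) ->
  `|gap (tperm x y @: S) F - gap S F| <= (#|~: S|%:R^-1 + #|S|%:R^-1) * B.
Proof.
move=> FB; rewrite gap_perm /gap /mean.
have h A := sum_tperm_dist A F B x y FB.
rewrite (_ : _ - _ = #|~: S|%:R^-1 *
    (\sum_(i in ~: S) F (tperm x y i) - \sum_(i in ~: S) F i)
  - #|S|%:R^-1 * (\sum_(i in S) F (tperm x y i) - \sum_(i in S) F i)); last ring.
apply: le_trans (ler_normB _ _) _; rewrite !normrM mulrDl !normfV !normr_nat.
by apply: lerD; rewrite ler_wpM2l ?invr_ge0 ?ler0n.
Qed.

(** * The largest eigenvalue *)

Section LargestEigenvalue.
Context {R : realType} {n : nat}.
Implicit Types (A K : 'M[R]_n) (x y v : 'rV[R]_n).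

Definition bform A x y : R := (x *m A *m y^T) 0 0.
Definition sqnorm {m} (v : 'rV[R]_m) : R := \sum_j v 0 j ^+ 2.

Lemma sqnorm_ge0 {m} (v : 'rV[R]_m) : 0 <= sqnorm v.
Proof. by apply: sumr_ge0 => j _; apply: sqr_ge0. Qed.

Lemma sqnormE {m} (v : 'rV[R]_m) : (v *m v^T) 0 0 = sqnorm v.
Proof. by rewrite mxE; apply: eq_bigr => j _; rewrite mxE expr2. Qed.

Lemma sqnorm_gt0 v : v != 0 -> 0 < sqnorm v.
Proof.
move=> v0; rewrite lt_def sqnorm_ge0 andbT; apply: contra v0 => /eqP h.
apply/eqP/rowP => j; rewrite mxE; apply/eqP; rewrite -sqrf_eq0; apply/eqP.
by apply: (psumr_eq0P _ h) => // i _; apply: sqr_ge0.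
Qed.

Lemma bform_bounded A : exists2 c, 0 <= c & forall v, `|bform A v v| <= c * sqnorm v.
Proof.
exists (\sum_j \sum_i `|A i j|) => [|v].
  by apply: sumr_ge0 => j _; apply: sumr_ge0.
rewrite /bform mxE mulr_suml; apply: le_trans (ler_norm_sum _ _ _) _.
apply: ler_sum => j _; rewrite mxE mulr_suml mulr_suml.
apply: le_trans (ler_norm_sum _ _ _) _; apply: ler_sum => i _.
have sq_le k : v 0 k ^+ 2 <= sqnorm v.
  by rewrite /sqnorm (bigD1 k) //= lerDl; apply: sumr_ge0 => l _; apply: sqr_ge0.
rewrite mxE [v 0 i * _]mulrC -mulrA normrM ler_wpM2l // ler_norml.
have := sq_le i; have := sq_le j.
have := sqr_ge0 (v 0 i - v 0 j); have := sqr_ge0 (v 0 i + v 0 j).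
by move=> h1 h2 h3 h4; apply/andP; split; lra.
Qed.

Lemma bformC A x y : A^T = A -> bform A x y = bform A y x.
Proof.
move=> sA; rewrite /bform.
have -> : (x *m A *m y^T) 0 0 = ((x *m A *m y^T)^T) 0 0 by rewrite [RHS]mxE.
by rewrite !trmx_mul trmxK sA mulmxA.
Qed.

Lemma bformDZ A x y (t : R) : A^T = A ->
  bform A (y - t *: x) (y - t *: x) =
  bform A y y - 2 * t * bform A y x + t ^+ 2 * bform A x x.
Proof.
move=> sA; have := bformC A x y sA; rewrite /bform.
have -> : (y - t *: x)^T = y^T - t *: x^T by rewrite linearB linearZ.
rewrite !mulmxBl !mulmxBr -!scalemxAl -!scalemxAr !mxE => h.
by rewrite h; ring.
Qed.

(* The supremum of the Rayleigh quotient is an eigenvalue: otherwise [M - K] is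
   positive semidefinite and invertible, hence bounded below by a positive
   multiple of the norm, and the supremum could be lowered. *)
Lemma lambda1_max K v : K^T = K -> bform K v v <= lambda1 K * sqnorm v.
Proof.
move=> sK; have [->|v0] := eqVneq v 0.
  rewrite /bform mul0mx mul0mx mxE /sqnorm big1 ?mulr0 // => j _.
  by rewrite mxE expr0n.
pose Ray := [set r | exists2 u : 'rV[R]_n, u != 0 & r = bform K u u / sqnorm u]%classic.
have [c0 c00 Kc] := bform_bounded K.
have ubR : has_ubound Ray.
  exists c0 => _ [u u0 ->]; rewrite ler_pdivrMr ?sqnorm_gt0 //.
  by apply: le_trans (Kc u); exact: ler_norm.
have neR : (Ray !=set0)%classic by exists (bform K v v / sqnorm v); exists v.
set M := sup Ray.
have KM u : bform K u u <= M * sqnorm u.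
  have [->|u0] := eqVneq u 0.
    rewrite /bform mul0mx mul0mx mxE /sqnorm big1 ?mulr0 // => j _.
    by rewrite mxE expr0n.
  rewrite -ler_pdivrMr ?sqnorm_gt0 //; apply: ub_le_sup => //; by exists u.
have eigM : eigenvalue K M.
  rewrite /eigenvalue /eigenspace kermx_eq0 row_free_unit; apply/negP => KMu.
  pose A := M%:M - K.
  have sA : A^T = A by rewrite /A linearB /= tr_scalar_mx sK.
  have Au : A \in unitmx.
    by rewrite -[A]opprK unitmxE -scaleN1r detZ unitrM unitrX ?unitrN1 //= -unitmxE opprB.
  have qA u : bform A u u = M * sqnorm u - bform K u u.
    rewrite /bform /A mulmxBr mulmxBl mul_mx_scalar -scalemxAl !mxE -sqnormE.
    by rewrite !mxE.
  have qA0 u : 0 <= bform A u u by rewrite qA subr_ge0.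
  have [c1 c10 Bc] := bform_bounded (invmx A)^T.
  pose c := c1 + 1; have c_gt0 : 0 < c by rewrite /c; lra.
  (* Positivity of the form at [y - c *: u] gives 2 c |u|^2 <= q(y) + c^2 q(u), where q is the form
     of [A], and q(y) <= c |u|^2. *)
  have lower u : sqnorm u <= c * bform A u u.
    pose y := u *m invmx A.
    have yA : y *m A = u by rewrite /y mulmxKV.
    have byu : bform A y u = sqnorm u by rewrite /bform yA sqnormE.
    have byy : bform A y y = bform (invmx A)^T u u.
      by rewrite /bform yA /y trmx_mul mulmxA.
    have := qA0 (y - c *: u); rewrite bformDZ // byu byy.
    have := Bc u; have := sqnorm_ge0 u; set N := sqnorm u => N0.
    rewrite ler_norml => /andP[_ le1] h.
    have : 0 <= c * (c * bform A u u - N).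
      by apply: le_trans h _; rewrite /c; lra.
    by rewrite pmulr_rge0 // subr_ge0.
  have : M <= M - c^-1.
    apply: ge_sup => // _ [u u0 ->]; have N0 := sqnorm_gt0 u u0.
    have := lower u; rewrite qA => h; rewrite -ler_pdivrMl // in h.
    rewrite ler_pdivrMr //; lra.
  have : 0 < c^-1 by rewrite invr_gt0.
  lra.
apply: le_trans (KM v) _; rewrite ler_wpM2r ?sqnorm_ge0 //.
(* The supremum in [lambda1] dominates [M] only if the eigenvalues are bounded above; evaluating at
   eigenvectors shows that [M] bounds them. *)
apply: ub_le_sup => //; exists M => a /eigenvalueP[u uK u0].
have : bform K u u <= M * sqnorm u := KM u.
rewrite /bform uK -scalemxAl mxE sqnormE ler_pM2r //; exact: sqnorm_gt0.
Qed.

End LargestEigenvalue.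

(** * Pairs and the Pref-Rank optimum *)

Lemma sum_symmetric {R : numDomainType} {n} (D : 'I_n -> 'I_n -> R) :
  (forall i j, D i j = D j i) ->
  \sum_i \sum_j D i j =
  2 * \sum_(p : pairs n) D (val p).1 (val p).2 + \sum_i D i i.
Proof.
move=> symD; rewrite pair_bigA /=.
have upper : \sum_(p : 'I_n * 'I_n | (p.1 < p.2)%N) D p.1 p.2 =
    \sum_(p : pairs n) D (val p).1 (val p).2.
  rewrite (reindex_omap (val : pairs n -> _) insub) /=; last first.
    by move=> p plt; rewrite insubT.
  by apply: eq_bigl => p; rewrite valK eqxx andbT (valP p).
rewrite (bigID (fun p : 'I_n * 'I_n => (p.1 < p.2)%N)) /= upper.
rewrite (bigID (fun p : 'I_n * 'I_n => (p.2 < p.1)%N)) /=.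
have -> : \sum_(p : 'I_n * 'I_n | ~~ (p.1 < p.2)%N && (p.2 < p.1)%N) D p.1 p.2 =
    \sum_(p : pairs n) D (val p).1 (val p).2.
  rewrite -upper (reindex_inj (h := fun p : 'I_n * 'I_n => (p.2, p.1))) /=; last first.
    by move=> [a b] [a' b'] [-> ->].
  apply: eq_big => [p|p _]; last exact: symD.
  by rewrite -leqNgt; case: ltnP => //; rewrite ?andbF //; lia.
have -> : \sum_(p : 'I_n * 'I_n | ~~ (p.1 < p.2)%N && ~~ (p.2 < p.1)%N) D p.1 p.2 =
    \sum_i D i i.
  rewrite (reindex_onto (fun i : 'I_n => (i, i)) fst) /=; last first.
    by move=> [a b] /= ab; congr (_, _); apply: val_inj => /=; lia.
  by apply: eq_bigl => i; rewrite ltnn eqxx.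
ring.
Qed.

(** The left side equals n times the sum of squares minus the square of the sum (the Laplacian of
    the complete graph). *)
Lemma sum_pairs_sqr_le {R : realType} {n} (a : 'I_n -> R) :
  \sum_(p : pairs n) (a (val p).1 - a (val p).2) ^+ 2 <= n%:R * \sum_i a i ^+ 2.
Proof.
have := sum_symmetric (fun i j => (a i - a j) ^+ 2) (fun i j => ltac:(ring)).
rewrite [X in _ + X]big1 => [|i _]; last by rewrite subrr expr0n.
have -> : \sum_i \sum_j (a i - a j) ^+ 2 =
    2 * (n%:R * \sum_i a i ^+ 2) - 2 * (\sum_i a i) ^+ 2.
  have -> : \sum_i \sum_j (a i - a j) ^+ 2 =
      \sum_(i < n) \sum_(j < n) a i ^+ 2 + \sum_(i < n) \sum_(j < n) a j ^+ 2 -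
      2 * \sum_i \sum_j a i * a j.
    rewrite mulr_sumr -big_split -sumrB /=; apply: eq_bigr => i _.
    rewrite mulr_sumr -big_split -sumrB /=; apply: eq_bigr => j _; ring.
  rewrite [X in X + _ - _]exchange_big /= sumr_const card_ord -mulr_natl.
  rewrite expr2 big_distrlr /=; ring.
have := sqr_ge0 (\sum_i a i); lra.
Qed.

Lemma card_pairs n : #|{: pairs n}| = 'C(n, 2).
Proof.
have := @sum_symmetric rat n (fun _ _ => 1) (fun _ _ => erefl).
rewrite !sumr_const !card_ord -mulrnA -(natrM _ 2) -natrD => /eqP; rewrite eqr_nat => /eqP.
move=> h; have {h} : (n * n = 2 * #|{: pairs n}| + n)%N := h.
have := mul_bin_diag n 1; rewrite bin1; move: #|_| 'C(n, 2) => a b; nia.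
Qed.

Section Geometry.
Context {R : realType} {n d : nat}.
Variables (U : 'M[R]_(d, n)).

Definition pair_vec (p : pairs n) (r : 'I_d) : R := U r (val p).1 - U r (val p).2.

(** Scores are differences of the entries of a = U^T w. To use K = U^T U rather than U U^T, write
    |a|^2 = <w, U a> and |U a|^2 = a^T K a <= lambda_1 |a|^2; Cauchy-Schwarz then gives |a|^2 <=
    lambda_1 |w|^2. *)
Lemma sum_score_sqr_le (w : 'cV[R]_d) : 0 <= lambda1 (U^T *m U) ->
  \sum_p score U w p ^+ 2 <= n%:R * lambda1 (U^T *m U) * \sum_r w r 0 ^+ 2.
Proof.
move=> lam0; pose a i := \sum_r U r i * w r 0.
have scoreE p : score U w p = a (val p).1 - a (val p).2.
  by rewrite /score /a -sumrB; apply: eq_bigr => r _; rewrite mulrBl.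
under eq_bigr => p _ do rewrite scoreE.
apply: le_trans (sum_pairs_sqr_le a) _; rewrite -mulrA ler_wpM2l ?ler0n //.
set K := U^T *m U; set A := \sum_i a i ^+ 2; set N := \sum_r w r 0 ^+ 2.
have A0 : 0 <= A by apply: sumr_ge0 => i _; apply: sqr_ge0.
have N0 : 0 <= N by apply: sumr_ge0 => i _; apply: sqr_ge0.
pose x : 'rV[R]_n := \row_i a i.
have xA : sqnorm x = A by apply: eq_bigr => i _; rewrite mxE.
have KT : K^T = K by rewrite /K trmx_mul trmxK.
pose b r := \sum_i U r i * a i.
have KxE : bform K x x = \sum_r b r ^+ 2.
  rewrite /bform /K mulmxA -mulmxA -{1}(trmxK x) -trmx_mul -[U in _ *m (U *m _)]trmxK.
  rewrite trmxK -{1}[U *m x^T]trmxK mxE; apply: eq_bigr => r _.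
  rewrite !mxE expr2; congr (_ * _); apply: eq_bigr => i _; rewrite !mxE //.
have AE : A = \sum_r w r 0 * b r.
  rewrite /A /b; under [RHS]eq_bigr => r _ do rewrite mulr_sumr.
  rewrite exchange_big /=; apply: eq_bigr => i _; rewrite expr2 {1}/a mulr_suml.
  by apply: eq_bigr => r _; rewrite mulrA [U r i * _]mulrC.
have CS := CauchySchwarz_sum (fun r => w r 0) b; rewrite -AE -/N in CS.
have lam := lambda1_max K x KT; rewrite KxE xA in lam.
have [->|An0] := eqVneq A 0; first by apply: mulr_ge0.
have A_gt0 : 0 < A by rewrite lt_def An0.
rewrite -(ler_pM2r A_gt0) -expr2; apply: le_trans CS _.
by rewrite mulrC -mulrA [N * A]mulrC mulrA ler_wpM2r.
Qed.

Section Lab.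
Variable e : rel 'I_n.
Hypothesis labU : in_Lab e U.

Lemma sum_column_sqr i : \sum_r U r i ^+ 2 = 1.
Proof.
rewrite -(labU.1 i) mxE; apply: eq_bigr => r _; by rewrite mxE expr2.
Qed.

Lemma lambda1_ge1 : (0 < n)%N -> 1 <= lambda1 (U^T *m U).
Proof.
move=> n0; pose i := Ordinal n0; set K := U^T *m U.
have KT : K^T = K by rewrite /K trmx_mul trmxK.
have := lambda1_max K (delta_mx 0 i) KT.
rewrite /bform -rowE trmx_delta -colE !mxE.
have -> : sqnorm (delta_mx 0 i : 'rV[R]_n) = 1.
  rewrite /sqnorm (bigD1 i) //= big1 => [|j ji]; rewrite mxE ?eqxx ?expr1n ?addr0 //=.
  by rewrite (negPf ji) expr0n.
rewrite mulr1; apply: le_trans; rewrite -(labU.1 i) mxE; exact: lexx.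
Qed.

(** Bounding each pair by 4 would give 2n(n - 1), too much for the mean bound when m = u + 1. *)
Lemma sum_pair_vec_sqr_le : \sum_p \sum_r pair_vec p r ^+ 2 <= n%:R ^+ 2.
Proof.
rewrite exchange_big /=; apply: (@le_trans _ _ (\sum_r (n%:R * \sum_i U r i ^+ 2))).
  by apply: ler_sum => r _; apply: (sum_pairs_sqr_le (U r)).
rewrite -mulr_sumr exchange_big /=; under eq_bigr => i _ do rewrite sum_column_sqr.
by rewrite sumr_const card_ord expr2.
Qed.

End Lab.
End Geometry.

(** * Strong convexity and stability of the optimum *)

Section PrefRank.
Context {R : realType} {n d : nat}.
Variables (U : 'M[R]_(d, n)) (s : 'S_n) (C : R).
Hypothesis C0 : 0 < C.
Implicit Types (S : {set pairs n}) (w v : 'cV[R]_d) (p : pairs n).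

Definition hinge w p : R := Num.max 0 (1 - ylabel R s p * score U w p).

Definition wnorm2 w : R := \sum_r w r 0 ^+ 2.

Lemma wnorm2_ge0 w : 0 <= wnorm2 w.
Proof. by apply: sumr_ge0 => r _; apply: sqr_ge0. Qed.

Lemma ylabel_cases p : ylabel R s p = 1 \/ ylabel R s p = -1.
Proof. by rewrite /ylabel; case: ifP; [right|left]. Qed.

Lemma scoreB w v p : score U (w - v) p = score U w p - score U v p.
Proof. by rewrite /score -sumrB; apply: eq_bigr => r _; rewrite !mxE mulrBr. Qed.

Lemma score_conv t w v p :
  score U ((1 - t) *: w + t *: v) p = (1 - t) * score U w p + t * score U v p.
Proof.
rewrite /score !mulr_sumr -big_split; apply: eq_bigr => r _ /=; rewrite !mxE; ring.
Qed.

Lemma hinge_conv t w v p : 0 <= t <= 1 ->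
  hinge ((1 - t) *: w + t *: v) p <= (1 - t) * hinge w p + t * hinge v p.
Proof.
move=> /andP[t0 t1]; rewrite /hinge score_conv; set y := ylabel R s p.
have h (x : R) : 0 <= Num.max 0 x by rewrite le_max lexx.
have h' (x : R) : x <= Num.max 0 x by rewrite le_max lexx orbT.
set a := score U w p; set b := score U v p.
have t1' : 0 <= 1 - t by lra.
rewrite ge_max; apply/andP; split; first by rewrite addr_ge0 // mulr_ge0.
have := ler_wpM2l t1' (h' (1 - y * a)); have := ler_wpM2l t0 (h' (1 - y * b)); lra.
Qed.

Lemma hinge_dist w v p : `|hinge w p - hinge v p| <= `|score U (w - v) p|.
Proof.
have max_dist (x y : R) : `|Num.max 0 x - Num.max 0 y| <= `|x - y|.
  case: (lerP 0 x) => hx; case: (lerP 0 y) => hy; case: (ler0P (x - y)) => h;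
    rewrite ?ler_norml; try (apply/andP; split); lra.
apply: le_trans (max_dist _ _) _; rewrite scoreB.
set a := score U w p; set b := score U v p; set y := ylabel R s p.
have -> : 1 - y * a - (1 - y * b) = - (y * (a - b)) by ring.
have y1 : `|y| = 1 by rewrite /y; case: (ylabel_cases p) => ->; rewrite ?normrN normr1.
by rewrite normrN normrM y1 mul1r.
Qed.

Lemma prefrank_objE S w : prefrank_obj U s C S w =
  2^-1 * wnorm2 w + C * \sum_(k in S) hinge w k.
Proof. by []. Qed.

Lemma wnorm2_conv t w v : wnorm2 ((1 - t) *: w + t *: v) =
  (1 - t) * wnorm2 w + t * wnorm2 v - t * (1 - t) * wnorm2 (v - w).
Proof.
rewrite /wnorm2 !mulr_sumr -big_split -sumrB /=; apply: eq_bigr => r _.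
rewrite !mxE; ring.
Qed.

Lemma prefrank_obj_conv S t w v : 0 <= t <= 1 ->
  prefrank_obj U s C S ((1 - t) *: w + t *: v) <=
  (1 - t) * prefrank_obj U s C S w + t * prefrank_obj U s C S v
  - 2^-1 * (t * (1 - t) * wnorm2 (v - w)).
Proof.
move=> t01; rewrite !prefrank_objE wnorm2_conv.
have : \sum_(k in S) hinge ((1 - t) *: w + t *: v) k <=
    (1 - t) * \sum_(k in S) hinge w k + t * \sum_(k in S) hinge v k.
  by rewrite !mulr_sumr -big_split; apply: ler_sum => k _; apply: hinge_conv.
rewrite -(ler_pM2l C0); lra.
Qed.

Lemma prefrank_opt_growth S w v : prefrank_opt U s C S w ->
  prefrank_obj U s C S w + 2^-1 * wnorm2 (v - w) <= prefrank_obj U s C S v.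
Proof.
move=> opt; rewrite leNgt; apply/negP => lt.
set D := wnorm2 (v - w) in lt *; set a := prefrank_obj U s C S w in lt *.
set b := prefrank_obj U s C S v in lt *.
have ab : a <= b := opt v.
have D0 : 0 < D by lra.
(* An explicit step replaces the limit t -> 0 in the strong convexity inequality; it leaves the
   contradiction 0 <= - t D / 2. *)
pose t := (2^-1 * D - (b - a)) / D.
have tD : t * D = 2^-1 * D - (b - a) by rewrite /t divfK // gt_eqF.
have t0 : 0 < t by rewrite /t divr_gt0 //; lra.
have t1 : t <= 2^-1 by rewrite /t ler_pdivrMr //; lra.
have t01 : 0 <= t <= 1 by apply/andP; split; lra.
have := le_trans (opt _) (prefrank_obj_conv S t w v t01); rewrite -/D -/a -/b => h.
have {}h : 0 <= t * ((b - a) - 2^-1 * ((1 - t) * D)) by lra.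
rewrite pmulr_rge0 // in h.
have : (1 - t) * D = D - t * D by ring.
rewrite tD => e; lra.
Qed.

Lemma prefrank_opt_unique S w v :
  prefrank_opt U s C S w -> prefrank_opt U s C S v -> score U w =1 score U v.
Proof.
move=> ow ov p; have := prefrank_opt_growth S w v ow.
have := ow v; have := ov w => h1 h2 h3.
have D0 : wnorm2 (v - w) = 0 by apply/eqP; rewrite eq_le wnorm2_ge0 andbT; lra.
apply/eqP; rewrite eq_sym -subr_eq0 -scoreB /score big1 // => r _.
have /eqP : (v - w) r 0 ^+ 2 = 0.
  by apply: (psumr_eq0P _ D0) => // i _; apply: sqr_ge0.
by rewrite sqrf_eq0 => /eqP ->; rewrite mulr0.
Qed.

(** Growth at 0 adds a second half of [wnorm2 w] to the one in the objective, so [wnorm2 w] is at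
    most [C] times the drop in hinge loss; comparing objective values alone would lose a factor 4.
    The drop is at most the sum of absolute scores on [S], bounded by Cauchy-Schwarz. *)
Lemma prefrank_opt_bounded S w : 0 <= lambda1 (U^T *m U) -> prefrank_opt U s C S w ->
  wnorm2 w <= C ^+ 2 * (#|S|%:R * (n%:R * lambda1 (U^T *m U))).
Proof.
move=> lam0 opt; have := prefrank_opt_growth S w 0 opt.
rewrite !prefrank_objE sub0r; set Q := wnorm2 w.
have -> : wnorm2 0 = 0 by apply: big1 => r _; rewrite mxE expr0n.
have -> : wnorm2 (- w) = Q by apply: eq_bigr => r _; rewrite mxE sqrrN.
set H0 := \sum_(k in S) hinge 0 k; set Hw := \sum_(k in S) _ => h.
have Hdiff : H0 - Hw <= \sum_(k in S) `|score U w k|.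
  rewrite /H0 /Hw -sumrB; apply: ler_sum => k _; apply: le_trans (ler_norm _) _.
  apply: le_trans (hinge_dist _ _ _) _.
  have -> : score U (0 - w) k = - score U w k.
    by rewrite sub0r /score -sumrN; apply: eq_bigr => r _; rewrite mxE mulrN.
  by rewrite normrN.
have Q0 : 0 <= Q := wnorm2_ge0 w.
set A := \sum_(k in S) _ in Hdiff.
have A0 : 0 <= A by apply: sumr_ge0.
have QA : Q <= C * A by have := Hdiff; rewrite -(ler_pM2l C0); lra.
have A2 : A ^+ 2 <= #|S|%:R * (n%:R * lambda1 (U^T *m U) * Q).
  have -> : A = \sum_k (k \in S)%:R * `|score U w k|.
    by rewrite /A big_mkcond; apply: eq_bigr => k _; case: (k \in S); rewrite ?mul1r ?mul0r.
  apply: le_trans (CauchySchwarz_sum _ _) _.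
  have -> : \sum_(k : pairs n) (k \in S)%:R ^+ 2 = #|S|%:R :> R.
    rewrite -sum1_card natr_sum [RHS]big_mkcond; apply: eq_bigr => k _.
    by case: (k \in S); rewrite ?expr1n ?expr0n.
  rewrite ler_wpM2l ?ler0n //; apply: le_trans (sum_score_sqr_le U w lam0).
  by apply: ler_sum => k _; rewrite real_normK ?num_real.
have [->|Qn0] := eqVneq Q 0.
  by rewrite mulr_ge0 ?sqr_ge0 // mulr_ge0 ?ler0n // mulr_ge0 ?ler0n.
have Q_gt0 : 0 < Q by rewrite lt_def Qn0.
rewrite -(ler_pM2r Q_gt0) -expr2.
apply: (@le_trans _ _ ((C * A) ^+ 2)).
  by rewrite lerXn2r ?nnegrE // mulr_ge0 // ltW.
by rewrite exprMn -[leRHS]mulrA ler_wpM2l ?sqr_ge0 // -[leRHS]mulrA.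
Qed.

(** Add the growth inequalities at the two optima: the shared pairs cancel, and only the hinge
    losses at [i] and [j] remain. *)
Lemma prefrank_opt_stable S i j w v :
  i \notin S -> j \notin S ->
  prefrank_opt U s C (i |: S) w -> prefrank_opt U s C (j |: S) v ->
  wnorm2 (w - v) <= C * (`|score U (w - v) i| + `|score U (w - v) j|).
Proof.
move=> iS jS ow ov.
have := prefrank_opt_growth _ _ v ow; have := prefrank_opt_growth _ _ w ov.
rewrite !prefrank_objE !finset.big_setU1 //=.
have -> : wnorm2 (v - w) = wnorm2 (w - v).
  by apply: eq_bigr => r _; rewrite -sqrrN !mxE opprB.
have := hinge_dist w v i; have := hinge_dist w v j.
rewrite !ler_norml => /andP[h1 h2] /andP[h3 h4] h5 h6.
have {}h1 := ler_wpM2l (ltW C0) h1; have {}h3 := ler_wpM2l (ltW C0) h3.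
have {}h2 := ler_wpM2l (ltW C0) h2; have {}h4 := ler_wpM2l (ltW C0) h4.
lra.
Qed.

End PrefRank.

(** * The error bound *)

Lemma mean_itv {R : realType} {I : finType} (A : {set I}) (F : I -> R) (B : R) :
  0 <= B -> (forall i, 0 <= F i <= B) -> 0 <= mean A F <= B.
Proof.
move=> B0 FB; have [->|A0] := eqVneq A finset.set0.
  by rewrite /mean big_set0 mulr0 lexx.
rewrite -[X in X <= _ <= _](mean_cst A 0 A0) -[X in _ <= _ <= X](mean_cst A B A0).
by apply/andP; split; apply: ler_mean => i _; have /andP[] := FB i.
Qed.

Lemma gap_itv {R : realType} {I : finType} (A : {set I}) (F : I -> R) (B : R) :
  0 <= B -> (forall i, 0 <= F i <= B) -> - B <= gap A F <= B.
Proof.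
move=> B0 FB; rewrite /gap; have /andP[h1 h2] := mean_itv (~: A) F B B0 FB.
by have /andP[h3 h4] := mean_itv A F B B0 FB; apply/andP; split; lra.
Qed.

Definition max_gap {R : realType} {P T : finType} (t0 : T) (G : T -> P -> R)
  (S : {set P}) : R := fmax t0 (fun t => gap S (G t)).

Lemma gap_tail_le {R : realType} {P T : finType} (t0 : T) (G : T -> P -> R)
    (B delta : R) (m u : nat) :
  (0 < m)%N -> (0 < u)%N -> (m + u = #|P|)%N ->
  0 <= B -> (forall t x, 0 <= G t x <= B) ->
  0 < delta -> delta < 1 ->
  #|[set S in slice [set: P] m | mean (slice [set: P] m) (max_gap t0 G) +
       (u%:R^-1 + m%:R^-1) * B * Num.sqrt (8 * m%:R * ln delta^-1) < max_gap t0 G S]|%:R <=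
  delta * #|slice [set: P] m|%:R.
Proof.
move=> m0 u0 muP B0 GB d0 d1; set Phi := max_gap t0 G.
have m0' : 0 < m%:R :> R by rewrite ltr0n.
have u0' : 0 < u%:R :> R by rewrite ltr0n.
have mX : (m <= #|[set: P]|)%N by rewrite cardsT; lia.
have ne : slice [set: P] m != finset.set0 by rewrite -finset.card_gt0 card_slice bin_gt0.
set L := ln delta^-1; have L0 : 0 < L by rewrite ln_gt0 // invf_gt1.
set beta := (_ + _) * B; set eps := beta * _.
have s0 : 0 < u%:R^-1 + m%:R^-1 :> R by rewrite addr_gt0 ?invr_gt0.
have beta0 : 0 <= beta by rewrite mulr_ge0 // ltW.
have eps0 : 0 <= eps by rewrite mulr_ge0 ?sqrtr_ge0.
have card_co S : S \in slice [set: P] m -> #|~: S| = u.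
  by rewrite inE => /andP[_ /eqP Sm]; have := cardsC S; rewrite Sm; lia.
have PhiB S : - B <= Phi S <= B.
  have [t Et] := fmax_attained t0 (fun t => gap S (G t)).
  by rewrite /Phi /max_gap Et gap_itv.
(* Gaps lie in [-B, B], so a large [eps] leaves no bad sample; a small one satisfies the constraint
   of [slice_tail_le] because [B <= m * beta]. *)
have [eps_big|eps_small] := leP (2 * B) eps.
  rewrite (_ : [set S in _ | _] = finset.set0) ?cards0 ?mulr_ge0 ?ler0n ?ltW //.
  apply/finset.setP => S; rewrite !inE; apply/negbTE/negP => /andP[_].
  have : - B <= mean (slice [set: P] m) Phi.
    by rewrite -[leLHS](mean_cst _ _ ne); apply: ler_mean => S' _; have /andP[] := PhiB S'.
  have /andP[_] := PhiB S; lra.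
have B_gt0 : 0 < B by lra.
have beta_gt0 : 0 < beta by rewrite mulr_gt0.
have mbeta : B <= m%:R * beta.
  rewrite /beta mulrA -{1}[B]mul1r ler_wpM2r // mulrDr mulfV ?gt_eqF //.
  by rewrite lerDr divr_ge0.
have := slice_tail_le [set: P] Phi beta eps m m0 mX beta_gt0.
have -> : expR (- (eps ^+ 2 / (8 * m%:R * beta ^+ 2))) = delta.
  rewrite /eps exprMn sqr_sqrtr ?mulr_ge0 ?ler0n ?(ltW L0) //.
  rewrite (_ : _ / _ = L); last by field; rewrite !gt_eqF.
  by rewrite /L lnV ?posrE // opprK lnK ?posrE.
move=> tail; rewrite [leRHS]mulrC; apply: tail => // [x y S _ _ SA|]; last lra.
have dist t : `|gap (tperm x y @: S) (G t) - gap S (G t)| <= beta.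
  rewrite /beta -(card_co S SA).
  have -> : m = #|S| by move: SA; rewrite inE => /andP[_ /eqP].
  exact: gap_tperm_dist.
have up : Phi (tperm x y @: S) <= Phi S + beta.
  apply: fmax_leD => t; have := dist t; rewrite ler_norml => /andP[_].
  by rewrite lerBlDl addrC.
have down : Phi S <= Phi (tperm x y @: S) + beta.
  apply: fmax_leD => t; have := dist t; rewrite ler_norml => /andP[+ _].
  by rewrite lerBrDr addrC lerBlDr.
by rewrite ler_norml; apply/andP; split; lra.
Qed.

(** [L] stands for n lambda_1. Since 1/sqrt(f(1-f)) >= 2, it suffices that sqrt(m) sqrt(k V / N) <=
    2 k, which is the last hypothesis. *)
Lemma complexity_le {R : realType} (C rho f L m k N V : R) :
  0 < C -> 0 < rho -> 0 < f -> f <= 2^-1 -> 0 <= L -> 0 < m -> 0 < k -> 0 < N -> 0 <= V ->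
  m * V <= 4 * k * N ->
  2 * (k^-1 * ((rho^-1 * (C * Num.sqrt (m * L))) * Num.sqrt (k * (N^-1 * V)))) <=
  2 * C * Num.sqrt L / (rho * Num.sqrt (f * (1 - f))).
Proof.
move=> C0 rho0 f0 f2 L0 m0 k0 N0 V0 mV.
have mge := ltW m0; have kge := ltW k0; have Nge := ltW N0; have Cge := ltW C0.
have rge := ltW rho0; set q := Num.sqrt (f * (1 - f)).
have q0 : 0 < q by rewrite sqrtr_gt0 mulr_gt0 //; lra.
have q2 : q <= 2^-1.
  rewrite -(@ler_pXn2r _ 2) ?nnegrE ?invr_ge0 ?sqrtr_ge0 // sqr_sqrtr; last first.
    by rewrite mulr_ge0 //; lra.
  have := sqr_ge0 (f - 2^-1); lra.
rewrite sqrtrM //; set sL := Num.sqrt L; set sm := Num.sqrt m.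
set sv := Num.sqrt (k * _).
have smv : sm * sv <= 2 * k.
  rewrite -sqrtrM // -(@ler_pXn2r _ 2) ?nnegrE ?sqrtr_ge0 ?mulr_ge0 //.
  rewrite sqr_sqrtr ?mulr_ge0 ?invr_ge0 //.
  have -> : m * (k * (N^-1 * V)) = k * (m * V / N) by ring.
  have -> : (2 * k) ^+ 2 = k * (4 * k) by ring.
  by rewrite ler_pM2l // ler_pdivrMr.
have a0 : 0 <= 2 * C * sL / rho.
  by rewrite divr_ge0 ?mulr_ge0 ?sqrtr_ge0 .
have -> : 2 * C * sL / (rho * q) = (2 * C * sL / rho) * q^-1.
  by field; rewrite !gt_eqF.
have -> : 2 * (k^-1 * (rho^-1 * (C * (sm * sL)) * sv)) =
    (2 * C * sL / rho) * (k^-1 * (sm * sv)).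
  by field; rewrite !gt_eqF.
rewrite ler_wpM2l //; apply: (@le_trans _ _ 2).
  by rewrite ler_pdivrMl // [leRHS]mulrC.
by rewrite -[2]invrK lef_pV2 ?posrE ?invr_gt0.
Qed.

(** With 1/u + 1/m = N/(u m), one factor 3 bounds N/u and the other bounds sqrt 8; the size [m] is
    replaced by its lower bound [N * f]. *)
Lemma deviation_le {R : realType} (B f L m u N : R) :
  0 <= B -> 0 < f -> f <= 2^-1 -> 0 <= L -> 0 < m -> 0 < u -> m + u = N ->
  N <= 3 * u -> N * f <= m ->
  (u^-1 + m^-1) * B * Num.sqrt (8 * m * L) <= 9 * B / (1 - f) * Num.sqrt (L / (N * f)).
Proof.
move=> B0 f0 f2 L0 m0 u0 muN N3 Nfm.
have N0 : 0 < N by lra.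
have mge := ltW m0; have uge := ltW u0; have Nge := ltW N0; have fge := ltW f0.
have -> : (u^-1 + m^-1) * B * Num.sqrt (8 * m * L) =
    (N / u) * (B * (Num.sqrt (8 * m * L) / m)).
  by rewrite -muN; field; rewrite !gt_eqF.
have -> : 9 * B / (1 - f) * Num.sqrt (L / (N * f)) =
    (3 / (1 - f)) * (B * (3 * Num.sqrt (L / (N * f)))).
  by field; rewrite gt_eqF //; lra.
have N_u : N / u <= 3 / (1 - f).
  apply: (@le_trans _ _ 3); first by rewrite ler_pdivrMr.
  rewrite ler_pdivlMr; lra.
apply: ler_pM => //.
- by rewrite divr_ge0 .
- by rewrite mulr_ge0 // divr_ge0 ?sqrtr_ge0 .
rewrite ler_wpM2l // -(@ler_pXn2r _ 2) ?nnegrE ?divr_ge0 ?mulr_ge0 ?sqrtr_ge0 //.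
rewrite !exprMn exprVn !sqr_sqrtr ?divr_ge0 ?mulr_ge0 //.
have -> : 8 * m * L / m ^+ 2 = 8 * (L / m) by field; rewrite gt_eqF.
have : L / m <= L / (N * f).
  by rewrite ler_wpM2l // lef_pV2 // posrE // mulr_gt0.
have : 0 <= L / (N * f) by rewrite divr_ge0 // mulr_ge0 //.
lra.
Qed.

(** For a, b the lengths of the vectors of [i], [j] and q that of [w - v], stability gives q <= C (a
    + b). The score is at most a q, and ab <= (a^2 + b^2)/2. *)
Lemma stable_score_le {R : realType} {n d : nat} (U : 'M[R]_(d, n)) (s : 'S_n) (C : R)
    (S : {set pairs n}) i j (w v : 'cV[R]_d) :
  0 < C -> i \notin S -> j \notin S ->
  prefrank_opt U s C (i |: S) w -> prefrank_opt U s C (j |: S) v ->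
  `|score U (w - v) i| <= C * (3 / 2 * \sum_r pair_vec U i r ^+ 2 +
                               2^-1 * \sum_r pair_vec U j r ^+ 2).
Proof.
move=> C0 iS jS ow ov.
have := prefrank_opt_stable U s C C0 S i j w v iS jS ow ov.
set D := w - v; set Q := wnorm2 D; have Q0 : 0 <= Q := wnorm2_ge0 D.
have V0 p : 0 <= \sum_r pair_vec U p r ^+ 2 by apply: sumr_ge0 => r _; apply: sqr_ge0.
have sc p : `|score U D p| <= Num.sqrt (\sum_r pair_vec U p r ^+ 2) * Num.sqrt Q.
  rewrite -sqrtrM // -sqrtr_sqr; apply: ler_wsqrtr.
  exact: (CauchySchwarz_sum (pair_vec U p) (fun r => D r 0)).
have hX := sc i; have hY := sc j.
have Ei := sqr_sqrtr (V0 i); have Ej := sqr_sqrtr (V0 j); have EQ := sqr_sqrtr Q0.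
have a0 := sqrtr_ge0 (\sum_r pair_vec U i r ^+ 2).
have b0 := sqrtr_ge0 (\sum_r pair_vec U j r ^+ 2).
have q0 := sqrtr_ge0 Q.
move: Ei Ej EQ hX hY a0 b0 q0 => <- <- <-; rewrite !sqrtr_sqr.
rewrite !(ger0_norm (sqrtr_ge0 _)).
move: (Num.sqrt (\sum_r _)) (Num.sqrt (\sum_r _)) (Num.sqrt Q) => b a q.
set X := `|score U D i|; set Y := `|score U D j| => hX hY a0 b0 q0 h.
have qle : q <= C * (a + b).
  have [->|qn0] := eqVneq q 0; first by rewrite mulr_ge0 ?addr_ge0 // ltW.
  have q_gt0 : 0 < q by rewrite lt_def qn0.
  rewrite -(ler_pM2r q_gt0) -expr2; apply: le_trans h _.
  by rewrite -mulrA ler_wpM2l ?(ltW C0) // mulrDl lerD.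
apply: le_trans hX _; apply: le_trans (ler_wpM2l a0 qle) _.
rewrite mulrCA ler_wpM2l ?(ltW C0) //; have := sqr_ge0 (a - b); lra.
Qed.

Lemma gap_leave_one_out {R : realType} {P : finType} (c : P) (F : P -> R) :
  (1 < #|P|)%N ->
  gap (~: [set c]) F = #|P|.-1%:R^-1 * \sum_(x | x != c) (F c - F x).
Proof.
move=> P1; have card_c : #|~: [set c]| = #|P|.-1 by rewrite cardsC1.
rewrite /gap /mean finset.setCK cards1 invr1 mul1r finset.big_set1 card_c.
have -> : \sum_(i in ~: [set c]) F i = \sum_(x | x != c) F x.
  by apply: eq_bigl => x; rewrite !inE.
have ne : #|P|.-1%:R != 0 :> R by rewrite pnatr_eq0; lia.
rewrite sumrB mulrBr sumr_const.
have -> : #|(fun x => x != c)| = #|P|.-1.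
  by rewrite -card_c; apply: eq_card => x; rewrite !inE.
by rewrite -[F c *+ _]mulr_natl mulKf.
Qed.

Lemma sum_off_diagonal {R : realType} {P : finType} (q : P -> R) :
  \sum_c \sum_(x | x != c) q c = #|P|.-1%:R * \sum_c q c /\
  \sum_c \sum_(x | x != c) q x = #|P|.-1%:R * \sum_c q c.
Proof.
have one : \sum_c \sum_(x | x != c) q c = #|P|.-1%:R * \sum_c q c.
  rewrite mulr_sumr; apply: eq_bigr => c _; rewrite sumr_const mulr_natl.
  by congr (_ *+ _); rewrite -(cardsC1 c); apply: eq_card => x; rewrite !inE.
split=> //; rewrite -one (exchange_big_dep predT) //=.
by apply: eq_bigr => c _; apply: eq_bigl => x; rewrite eq_sym.
Qed.

Section Assembly.
Context {R : realType} {n d : nat}.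
Variables (e : rel 'I_n) (U : 'M[R]_(d, n)) (s : 'S_n) (C f B rho : R) (l : R -> R -> R).
Hypotheses (n2 : (2 <= n)%N) (labU : in_Lab e U) (C0 : 0 < C) (rho0 : 0 < rho).
Hypotheses (f0 : 0 < f) (f2 : f <= 2^-1).
Hypothesis lB : forall y a, (y = 1 \/ y = -1) -> 0 <= l y a <= B.
Hypothesis lLip : forall y a a', (y = 1 \/ y = -1) ->
  `|l y a - l y a'| <= rho^-1 * `|a - a'|.

Definition loss (w : 'cV[R]_d) (p : pairs n) : R := l (ylabel R s p) (score U w p).

Lemma loss_itv w p : 0 <= loss w p <= B.
Proof. exact/lB/ylabel_cases. Qed.

Lemma loss_lip w v p : `|loss w p - loss v p| <= rho^-1 * `|score U w p - score U v p|.
Proof. exact/lLip/ylabel_cases. Qed.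

Lemma sum_leave_one_out_gap_le (w : pairs n -> 'cV[R]_d) :
  (1 < #|{: pairs n}|)%N -> (forall c, prefrank_opt U s C (~: [set c]) (w c)) ->
  \sum_c gap (~: [set c]) (loss (w c)) <= 2 * (C / rho) * n%:R ^+ 2.
Proof.
move=> P1 ow; set N1 := #|{: pairs n}|.-1; pose q c := \sum_r pair_vec U c r ^+ 2.
have N1_gt0 : 0 < N1%:R :> R by rewrite ltr0n /N1; lia.
under eq_bigr => c _ do rewrite gap_leave_one_out //.
rewrite -mulr_sumr ler_pdivrMl //.
(* Renaming indices in the subtracted sum compares two optima at the same pair [c], trained on
   samples that differ in one pair. *)
have -> : \sum_c \sum_(x | x != c) (loss (w c) c - loss (w c) x) =
    \sum_c \sum_(x | x != c) (loss (w c) c - loss (w x) c).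
  under eq_bigr => c _ do rewrite sumrB.
  under [RHS]eq_bigr => c _ do rewrite sumrB.
  rewrite !sumrB; congr (_ - _); rewrite (exchange_big_dep predT) //=.
  by apply: eq_bigr => c _; apply: eq_bigl => x; rewrite eq_sym.
have term c x : x != c ->
    loss (w c) c - loss (w x) c <= C / rho * (3 / 2 * q c + 2^-1 * q x).
  move=> xc; apply: le_trans (ler_norm _) _; apply: le_trans (loss_lip _ _ _) _.
  rewrite mulrAC [leRHS]mulrC ler_wpM2l ?invr_ge0 ?(ltW rho0) //.
  rewrite distrC -scoreB.
  have cU : ~: [set x] = c |: ~: [set c; x].
    apply/finset.setP => z; rewrite !inE; case: (eqVneq z c) => [->|] //=.
    by rewrite eq_sym xc.
  have xU : ~: [set c] = x |: ~: [set c; x].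
    apply/finset.setP => z; rewrite !inE; case: (eqVneq z x) => [->|] //=.
    by rewrite orbF.
  have ox := ow x; have oc := ow c; rewrite cU in ox; rewrite xU in oc.
  by apply: stable_score_le ox oc; rewrite // !inE eqxx ?orbT.
have [off1 off2] := sum_off_diagonal q.
apply: (@le_trans _ _ (\sum_c \sum_(x | x != c) (C / rho * (3 / 2 * q c + 2^-1 * q x)))).
  by apply: ler_sum => c _; apply: ler_sum => x; apply: term.
under eq_bigr => c _ do rewrite -mulr_sumr big_split -!mulr_sumr /=.
rewrite -mulr_sumr big_split -!mulr_sumr /= off1 off2 -/N1.
have qn : \sum_c q c <= n%:R ^+ 2 := sum_pair_vec_sqr_le U e labU.
have a0 : 0 <= 2 * (C / rho) * N1%:R by rewrite !mulr_ge0 ?invr_ge0 ?ltW.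
have := ler_wpM2l a0 qn; lra.
Qed.

Definition lam := lambda1 (U^T *m U).
Definition threshold N delta : R :=
  2 * C * Num.sqrt (n%:R * lam) / (rho * Num.sqrt (f * (1 - f))) +
  9 * B / (1 - f) * Num.sqrt (ln delta^-1 / (N%:R * f)).
Definition good t (S : {set pairs n}) : Prop :=
  forall w, prefrank_opt U s C S w -> gap S (loss w) <= t.

Lemma B_ge0 : 0 <= B.
Proof. by have /andP[] := lB 1 0 (or_introl erefl); apply: le_trans. Qed.

Lemma lam_ge1 : 1 <= lam.
Proof. by apply: lambda1_ge1 labU _; lia. Qed.

Lemma slice_setT m : slice [set: pairs n] m = [set S : {set pairs n} | #|S| == m].
Proof. by apply/finset.setP => S; rewrite !inE finset.subsetT. Qed.

Lemma bad_large_sample m u delta :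
  (0 < m)%N -> (0 < u)%N -> (m + u = #|{: pairs n}|)%N ->
  (m * n <= 2 * minn m u * n.-1)%N -> (m + u <= 3 * u)%N ->
  (m + u)%:R * f <= m%:R -> 0 < delta -> delta < 1 ->
  #|[set S in slice [set: pairs n] m | ~~ `[<good (threshold (m + u) delta) S>]]|%:R <=
  delta * #|slice [set: pairs n] m|%:R.
Proof.
move=> m0 u0 muN mn3 mu3 Nfm d0 d1; set k := minn m u.
have k0 : (0 < k)%N by rewrite /k; lia.
have lam0 : 0 <= lam by apply: le_trans lam_ge1.
(* The zero vector stands in for subsets of another size or without an optimum, which keeps the norm
   bound uniform. *)
have pick_opt (t : {set pairs n}) : exists w : 'cV[R]_d,
    wnorm2 w <= C ^+ 2 * (m%:R * (n%:R * lam)) /\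
    forall v, #|t| = m -> prefrank_opt U s C t v -> score U w =1 score U v.
  have [[v [tm ov]]|no] := pselect (exists v, #|t| = m /\ prefrank_opt U s C t v).
    exists v; split; first by rewrite -tm; apply: prefrank_opt_bounded ov.
    by move=> v' _ ov'; apply: prefrank_opt_unique ov ov'.
  exists 0; split=> [|v tm ov]; last by case: no; exists v.
  rewrite /wnorm2 big1 => [|r _]; last by rewrite mxE expr0n.
  by rewrite mulr_ge0 ?sqr_ge0 // !mulr_ge0 ?ler0n.
have [wt wtP] := choice pick_opt.
pose G t := loss (wt t); pose Phi := max_gap finset.set0 G.
(* Absorbing the Lipschitz constant into the weights gives the comparison with constant 1 that
   contraction requires. *)
pose w' t r := rho^-1 * wt t r 0.
pose W := rho^-1 * (C * Num.sqrt (m%:R * (n%:R * lam))).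
have W0 : 0 <= W by rewrite mulr_ge0 ?invr_ge0 ?mulr_ge0 ?sqrtr_ge0 // ltW.
have wW t : \sum_r w' t r ^+ 2 <= W ^+ 2.
  have [wn _] := wtP t.
  rewrite /W !exprMn sqr_sqrtr; last by rewrite !mulr_ge0 ?ler0n.
  under eq_bigr => r _ do rewrite exprMn.
  by rewrite -mulr_sumr ler_wpM2l ?sqr_ge0.
have linE t x : \sum_r pair_vec U x r * w' t r = rho^-1 * score U (wt t) x.
  by rewrite /score mulr_sumr; apply: eq_bigr => r _; rewrite /w' mulrCA.
have Glip x t t' : `|G t x - G t' x| <=
    `|\sum_r pair_vec U x r * w' t r - \sum_r pair_vec U x r * w' t' r|.
  rewrite !linE -mulrBr normrM ger0_norm ?invr_ge0 ?(ltW rho0) //; exact: loss_lip.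
pose V := \sum_(x : pairs n) \sum_r pair_vec U x r ^+ 2.
have meanPhi : mean (slice [set: pairs n] m) Phi <=
    2 * C * Num.sqrt (n%:R * lam) / (rho * Num.sqrt (f * (1 - f))).
  rewrite slice_setT.
  have kmN : (k + m <= #|{: pairs n}|)%N by rewrite -muN addnC leq_add2l geq_minr.
  have km : (k <= m)%N := geq_minl m u.
  have := mean_gap_le _ _ finset.set0 w' (pair_vec U) W G W0 wW Glip m k k0 km kmN.
  move/le_trans; apply; rewrite -muN.
  apply: complexity_le => //; rewrite ?ltr0n ?addn_gt0 ?m0 //.
  - by rewrite mulr_ge0 ?ler0n.
  - by apply: sumr_ge0 => x _; apply: sumr_ge0 => r _; apply: sqr_ge0.
  - apply: (@le_trans _ _ (m%:R * n%:R ^+ 2)).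
      by rewrite ler_wpM2l ?ler0n //; apply: sum_pair_vec_sqr_le labU.
    rewrite -natrX -!natrM ler_nat.
    have := mul_bin_diag n 1; rewrite bin1 -card_pairs -muN => nE.
    by have := leq_mul (leqnn n) mn3; rewrite -/k; nia.
have dev : (u%:R^-1 + m%:R^-1) * B * Num.sqrt (8 * m%:R * ln delta^-1) <=
    9 * B / (1 - f) * Num.sqrt (ln delta^-1 / ((m + u)%:R * f)).
  apply: deviation_le; rewrite ?B_ge0 ?ltr0n ?natrD //; last by rewrite -natrD.
    by rewrite ltW // ln_gt0 // invf_gt1.
  by rewrite -natrD -natrM ler_nat.
have tail := gap_tail_le finset.set0 G B delta m u m0 u0 muN B_ge0
  (fun t => loss_itv _) d0 d1.
apply: le_trans tail; rewrite ler_nat; apply: subset_leq_card.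
apply/fintype.subsetP => S; rewrite !inE => /andP[SA nS]; rewrite SA /= -/Phi.
have /andP[_ /eqP Sm] := SA; rewrite ltNge; apply: contra nS => PhiS.
apply/asboolP => w ow; have [_ uniqS] := wtP S.
have -> : gap S (loss w) = gap S (G S).
  by congr gap; apply: funext => x; rewrite /G /loss (uniqS w Sm ow).
apply: le_trans (fmax_ge finset.set0 (fun t => gap S (G t)) S) _.
by apply: le_trans PhiS _; rewrite lerD.
Qed.

Lemma one_minus_f_gt0 : 0 < 1 - f.
Proof. by move: f2; lra. Qed.

Lemma sqrt_variance_le : Num.sqrt (f * (1 - f)) <= 2^-1.
Proof.
rewrite -(@ler_pXn2r _ 2) ?nnegrE ?invr_ge0 ?sqrtr_ge0 // sqr_sqrtr; last first.
  by rewrite mulr_ge0 // ltW // one_minus_f_gt0.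
have := sqr_ge0 (f - 2^-1); lra.
Qed.

Lemma sqrt_variance_gt0 : 0 < Num.sqrt (f * (1 - f)).
Proof. by rewrite sqrtr_gt0 mulr_gt0 // one_minus_f_gt0. Qed.

Lemma bad_all_good m t (delta : R) :
  0 < delta -> (forall S : {set pairs n}, #|S| = m -> good t S) ->
  #|[set S in slice [set: pairs n] m | ~~ `[<good t S>]]|%:R <=
  delta * #|slice [set: pairs n] m|%:R.
Proof.
move=> d0 allgood; rewrite (_ : [set S in _ | _] = finset.set0).
  by rewrite cards0 mulr_ge0 ?ler0n // ltW.
apply/finset.setP => S; rewrite !inE; apply/negbTE/negP => /andP[/andP[_ /eqP Sm]].
by move/asboolP; apply; apply: allgood.
Qed.

Lemma threshold_ge0 N delta :
  0 <= 2 * C * Num.sqrt (n%:R * lam) / (rho * Num.sqrt (f * (1 - f))) /\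
  0 <= 9 * B / (1 - f) * Num.sqrt (ln delta^-1 / (N%:R * f)).
Proof.
have Cge := ltW C0; have rge := ltW rho0; have q0 := ltW sqrt_variance_gt0.
split; first by rewrite divr_ge0 // !mulr_ge0 ?sqrtr_ge0.
have := ltW one_minus_f_gt0 => ?.
by rewrite mulr_ge0 ?sqrtr_ge0 // divr_ge0 // mulr_ge0 // B_ge0.
Qed.

(* With three pairs and two of them observed the Rademacher bound is too weak; here
   stability of the optimum bounds the average gap over the three samples. *)
Lemma bad_two_of_three delta :
  n = 3 -> 0 < delta -> delta < 1 ->
  #|[set S in slice [set: pairs n] 2 | ~~ `[<good (threshold 3 delta) S>]]|%:R <=
  delta * #|slice [set: pairs n] 2|%:R.
Proof.
move=> n3 d0 d1; set Bad := [set S in _ | _].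
have N3 : #|{: pairs n}| = 3 by rewrite card_pairs n3.
have slice3 : #|slice [set: pairs n] 2| = 3 by rewrite card_slice cardsT N3.
have [T0 third0] := threshold_ge0 3 delta.
(* Below 2/3, [ln delta^-1 >= 1 - delta >= 1/3] makes the last term at least 3 B, which no gap
   exceeds. *)
have [d23|d23] := ltP delta (2 / 3).
  apply: bad_all_good => // S _ w _.
  have /andP[_ gB] := gap_itv S (loss w) B B_ge0 (loss_itv w).
  apply: le_trans gB _; apply: (@le_trans _ _ (9 * B / (1 - f) *
    Num.sqrt (ln delta^-1 / (3%:R * f)))); last by rewrite /threshold lerDr.
  have lnd : 3^-1 <= ln delta^-1.
    have h : -1 < delta - 1 by lra.
    have := le_ln1Dx h; rewrite lnV ?posrE // (_ : 1 + (delta - 1) = delta); [lra|ring].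
  have s3 : 3^-1 <= Num.sqrt (ln delta^-1 / (3%:R * f)).
    have h9 : 9^-1 <= ln delta^-1 / (3%:R * f).
      by rewrite ler_pdivlMr ?mulr_gt0 //; move: f2; lra.
    rewrite -(@ler_pXn2r _ 2) ?nnegrE ?invr_ge0 ?sqrtr_ge0 // sqr_sqrtr; last lra.
    by apply: le_trans h9; rewrite exprVn; lra.
  have b1 : 9 * B <= 9 * B / (1 - f).
    have f1 := one_minus_f_gt0.
    have := B_ge0 => b0; rewrite ler_pdivlMr //.
    have : 0 <= B * f by rewrite mulr_ge0 // ltW.
    lra.
  have b0 : 0 <= 9 * B by rewrite mulr_ge0 ?B_ge0.
  have third_ge0 : 0 <= 3^-1 :> R by rewrite invr_ge0.
  have := ler_pM b0 third_ge0 b1 s3.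
  have := B_ge0; lra.
(* Now two bad samples out of three are allowed. Were all three bad, their gaps would sum to more
   than 3 * 6 C / rho, while stability bounds the sum by 2 (C / rho) * 9. *)
rewrite slice3; suff bad2 : (#|Bad| <= 2)%N.
  have : #|Bad|%:R <= 2%:R :> R by rewrite ler_nat.
  lra.
rewrite leqNgt; apply/negP => bad3.
have BadE : Bad = slice [set: pairs n] 2.
  apply/eqP; rewrite eqEcard slice3 bad3 andbT.
  by apply/fintype.subsetP => S; rewrite inE => /andP[].
have witness (c : pairs n) : exists w, prefrank_opt U s C (~: [set c]) w /\
    threshold 3 delta < gap (~: [set c]) (loss w).
  have : ~: [set c] \in Bad.
    by rewrite BadE inE finset.subsetT cardsC1 N3.
  rewrite inE => /andP[_ /asboolP ngood].
  have [//|no] := pselect (exists w, prefrank_opt U s C (~: [set c]) w /\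
    threshold 3 delta < gap (~: [set c]) (loss w)).
  case: ngood => w ow; rewrite leNgt; apply/negP => lt; apply: no; by exists w.
have [w wP] := choice witness.
have P1 : (1 < #|{: pairs n}|)%N by rewrite N3.
have upper := sum_leave_one_out_gap_le w P1 (fun c => (wP c).1).
have strict : \sum_(c : pairs n) threshold 3 delta < \sum_c gap (~: [set c]) (loss (w c)).
  apply: ltr_sum => [|c _]; last exact: (wP c).2.
  apply/hasP; have [c _] : exists c, c \in {: pairs n} by apply/card_gt0P; rewrite N3.
  by exists c; rewrite ?mem_index_enum.
have n9 : n%:R = 3%:R :> R by rewrite n3.
(* Uses sqrt(3 lambda_1) >= 3/2 and sqrt(f(1-f)) <= 1/2. *)
have lb : 6 * (C / rho) <= 2 * C * Num.sqrt (n%:R * lam) / (rho * Num.sqrt (f * (1 - f))).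
  rewrite n9.
  have q0 := sqrt_variance_gt0; have q2 := sqrt_variance_le.
  set q := Num.sqrt (f * _) in q0 q2 *.
  have sq : 3 / 2 <= Num.sqrt (3%:R * lam).
    have l1 := lam_ge1.
    rewrite -(@ler_pXn2r _ 2) ?nnegrE ?divr_ge0 ?sqrtr_ge0 // sqr_sqrtr; last lra.
    lra.
  set sl := Num.sqrt _ in sq *.
  have -> : 2 * C * sl / (rho * q) = C / rho * (2 * (sl / q)).
    by field; rewrite !gt_eqF.
  have h3 : 3 <= sl / q by rewrite ler_pdivlMr //; lra.
  rewrite mulrC ler_wpM2l ?divr_ge0 ?(ltW C0) ?(ltW rho0) //; lra.
have lb_threshold : 6 * (C / rho) <= threshold 3 delta.
  by apply: le_trans lb _; rewrite lerDl.
have := lt_le_trans strict upper.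
rewrite sumr_const N3 -[_ *+ 3]mulr_natr n9; lra.
Qed.

Lemma bad_le m delta :
  (0 < m)%N -> (2 * m <= 'C(n, 2).+1)%N -> 'C(n, 2)%:R * f <= m%:R -> 0 < delta ->
  #|[set S in slice [set: pairs n] m | ~~ `[<good (threshold 'C(n, 2) delta) S>]]|%:R <=
  delta * #|slice [set: pairs n] m|%:R.
Proof.
move=> m0 mN Nfm d0; have binE := mul_bin_diag n 1; rewrite bin1 in binE.
have [d1|d1] := leP 1 delta.
  apply: (@le_trans _ _ #|slice [set: pairs n] m|%:R).
    rewrite ler_nat; apply: subset_leq_card.
    by apply/fintype.subsetP => S; rewrite inE => /andP[].
  by rewrite ler_peMl ?ler0n.
have cardN := card_pairs n.
(* With a single pair the test set is empty, its error is 0, and the gap is nonpositive. *)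
have [n2'|n3] := eqVneq n 2%N.
  have N1 : 'C(n, 2) = 1%N by rewrite n2'.
  have m1 : m = 1%N by lia.
  apply: bad_all_good => // S Sm w _.
  have [T0 third0] := threshold_ge0 'C(n, 2) delta.
  have -> : gap S (loss w) = - mean S (loss w).
    have co0 : ~: S = finset.set0.
      apply/eqP; rewrite -cards_eq0; have := cardsC S; rewrite Sm m1 cardN N1; lia.
    by rewrite /gap co0 {1}/mean big_set0 mulr0 sub0r.
  have /andP[m_ge0 _] := mean_itv S (loss w) B B_ge0 (loss_itv w).
  rewrite /threshold; lra.
have N3 : (3 <= 'C(n, 2))%N by nia.
have [/andP[/eqP n3' /eqP m2]|not32] := boolP ((n == 3) && (m == 2)).
  have -> : 'C(n, 2) = 3%N by rewrite n3'.
  by rewrite m2; apply: bad_two_of_three.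
have muN : (m + ('C(n, 2) - m) = 'C(n, 2))%N by lia.
have := @bad_large_sample m ('C(n, 2) - m) delta; rewrite muN; apply=> //.
- lia.
- have [mu|um] := leqP m ('C(n, 2) - m).
    by nia.
  (* Here N = 2m - 1; excluding n = 3 forces n and m to be at least 4, enough for m n <= 2 (m - 1)(n
     - 1). *)
  have mE : ('C(n, 2) - m = m.-1)%N by lia.
  have n4 : (4 <= n)%N by move: not32; rewrite negb_and; nia.
  have m4 : (4 <= m)%N by nia.
  by rewrite mE; nia.
- lia.
Qed.

End Assembly.

Theorem theorem4 (R : realType) :
  exists C1 : R, 0 < C1 /\
  forall (n d : nat) (e : rel 'I_n) (U : 'M[R]_(d, n)) (s : 'S_n)
         (C f B rho : R) (l : R -> R -> R) (delta : R),
    (2 <= n)%N ->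
    simple_graph e ->
    in_Lab e U ->
    0 < C ->
    0 < f -> f <= 2^-1 ->
    0 < rho ->
    (forall y a, (y = 1 \/ y = -1) -> 0 <= l y a <= B) ->
    (forall y a a', (y = 1 \/ y = -1) -> `|l y a - l y a'| <= rho^-1 * `|a - a'|) ->
    0 < delta ->
    let N := 'C(n, 2) in
    let m := Num.ceil (N%:R * f) in
    exists E : {set {set pairs n}},
      (forall S, S \in E ->
         (#|S|%:Z = m) /\
         forall w, prefrank_opt U s C S w ->
           er s l (~: S) (score U w) <=
             er s l S (score U w)
             + 2 * C * Num.sqrt (n%:R * lambda1 (U^T *m U))
                 / (rho * Num.sqrt (f * (1 - f)))
             + C1 * B / (1 - f) * Num.sqrt (ln (delta^-1) / (N%:R * f))) /\
      1 - delta <= #|E|%:R / #|[set S : {set pairs n} | #|S|%:Z == m]|%:R.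
Proof.
exists 9; split=> [|n d e U s C f B rho l delta n2 _ labU C0 f0 f2 rho0 lB lLip d0 N M].
  by rewrite ltr0n.
have N0 : (0 < N)%N by rewrite /N bin_gt0.
have Nf0 : 0 < N%:R * f by rewrite mulr_gt0 // ltr0n.
have : 0 < M by rewrite ceil_gt0.
case ME : M => [m|//]; rewrite ltz_nat => m0.
have Nfm : N%:R * f <= m%:R.
  by have := ceil_le_int (N%:R * f) m%:Z; rewrite -/M ME lexx => <-.
(* By the ceiling, m - 1 < N f <= N/2. *)
have mN : (2 * m <= N.+1)%N.
  have := ceil_gt_int (N%:R * f) m.-1%:Z; rewrite -/M ME ltz_nat.
  rewrite prednK // leqnn => /esym lt.
  have Nf2 : N%:R * f <= N%:R * 2^-1 by rewrite ler_wpM2l ?ler0n.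
  have : m.-1%:R * 2 < N%:R :> R.
    by rewrite -ltr_pdivlMr //; apply: lt_le_trans Nf2.
  by rewrite -natrM ltr_nat; lia.
have bad := bad_le e U s C f B rho l n2 labU C0 rho0 f0 f2 lB lLip m delta m0 mN Nfm d0.
set t := threshold _ _ _ _ _ _ _ in bad; set A := slice _ m in bad.
have slice_ceil : [set S : {set pairs n} | #|S|%:Z == m%:Z] = A.
  by rewrite /A slice_setT; apply/finset.setP => S; rewrite !inE eqz_nat.
exists [set S in A | `[<good U s C l t S>]]; split=> [S|].
  rewrite inE => /andP[+ /asboolP goodS]; rewrite inE => /andP[_ /eqP Sm].
  split=> [|w ow]; first by rewrite Sm.
  rewrite -addrA -lerBlDl; exact: goodS.
rewrite slice_ceil; have A0 : (0 < #|A|)%N.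
  by rewrite card_slice bin_gt0 cardsT card_pairs -/N; lia.
rewrite ler_pdivlMr ?ltr0n // mulrBl mul1r lerBlDr; apply: le_trans (lerD (lexx _) bad).
rewrite -natrD ler_nat -(cardsID [set S | `[<good U s C l t S>]] A).
rewrite leq_add // subset_leq_card //; apply/fintype.subsetP => S; rewrite !inE //.
by case/andP => -> ->.
Qed.
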